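(* Let $(U,\mathrm{dist})$ be a metric space of doubling dimension $D$, let $S\subseteq U$ be a finite set with aspect ratio $\Delta$, let $M=(S,I)$ be a matroid on $S$ accessible through a constant-time independence oracle, and let $\epsilon>0$. There is an algorithm that, given an augmented cover tree $T$ for $S$ with respect to $M$ (in explicit representation) and $\epsilon$, returns an independent set $C\in I$ with $r_C(S)\le(3+O(\epsilon))\,r^*(M)$, in time $O\big(\mathrm{poly}(\mathrm{rank}(M),(64/\epsilon)^D)+\mathrm{rank}(M)\log\Delta\big)$.
   Context: The doubling dimension of $(U,\mathrm{dist})$ is the minimum $D\ge0$ such that every ball $B(p,r)=\{q\in U:\mathrm{dist}(p,q)\le r\}$ is contained in the union of at most $2^D$ balls of radius $r/2$ centered at points of $U$. The aspect ratio of $S$ is $\Delta=d_{\max}/d_{\min}$, the ratio of the maximum and minimum distances between two distinct points of $S$. For $C\subseteq S$, $r_C(S)=\max_{p\in S}\min_{q\in C}\mathrm{dist}(p,q)$. The matroid center problem on $M=(S,I)$ asks for $C\in I$ minimizing $r_C(S)$; $r^*(M)=\min_{C\in I}r_C(S)$. $\mathrm{rank}(M)$ is the common size of the maximal independent sets of $M$. A cover tree $T$ for $S$ is a rooted tree with levels indexed by integers decreasing from the root; $T_\ell$ is the set of nodes at level $\ell$, each node $u$ is associated with a point $u.\mathrm{point}\in S$, the points of the nodes of $T_\ell$ are distinct, and every non-root node of $T_\ell$ has a parent in $T_{\ell+1}$. Writing $\mathrm{dist}(u,v)=\mathrm{dist}(u.\mathrm{point},v.\mathrm{point})$, for every level $\ell$: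 (1) the points of $T_\ell$ are contained in the points of $T_{\ell-1}$; (2) $\mathrm{dist}(u,u.\mathrm{parent})\le 2^{\ell+1}$ for $u\in T_\ell$; (3) $\mathrm{dist}(u,v)>2^\ell$ for distinct $u,v\in T_\ell$. In the explicit representation, maximal chains of same-point nodes each having only the same-point child are coalesced into a single node. An augmented cover tree for $S$ with respect to $M$ stores at each node $u$ the value $u.\mathrm{weight}=|S_u|$ and a maximal independent set $u.\mathrm{mis}$ of the restriction of $M$ to $S_u$, where $S_u$ is the set of points associated with nodes in the subtree rooted at $u$. *)

(* Defs.v *)
From Stdlib Require List.
From HB Require Import structures.
From mathcomp Require Import all_boot all_order all_algebra finmap.
From mathcomp Require Import all_classical all_reals all_analysis.

Set Implicit Arguments.
Unset Strict Implicit.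
Unset Printing Implicit Defensive.

Import Order.TTheory GRing.Theory Num.Theory.
Local Open Scope ring_scope.

Section Metric.
Variables (R : realType) (U : metricType R).
Local Open Scope classical_set_scope.

(* The library's [ball] is open; these balls are closed. *)
Definition cball (p : U) (r : R) : set U := [set q | mdist p q <= r].

Definition doubling (D : R) : Prop :=
  forall (p : U) (r : R), exists X : {fset U},
    (#|` X|%:R <= 2 `^ D) /\
    cball p r `<=` \bigcup_(x in [set` X]) cball x (r / 2).

Definition is_doubling_dimension (D : R) : Prop :=
  [/\ 0 <= D, doubling D & forall D', 0 <= D' -> doubling D' -> D <= D'].

Variable S : {fset U}.

Definition fdist (p q : S) : R := mdist (val p) (val q).

Definition max_dist : R :=
  \big[Order.max/0]_(pq : S * S | pq.1 != pq.2) fdist pq.1 pq.2.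

(* [max_dist] is a neutral default here, being at least every term. *)
Definition min_dist : R :=
  \big[Order.min/max_dist]_(pq : S * S | pq.1 != pq.2) fdist pq.1 pq.2.

(* If S has a single point, this is 0 / 0 = 0, and then [ln aspect_ratio] = 0. *)
Definition aspect_ratio : R := max_dist / min_dist.

Local Open Scope ereal_scope.

(* Extended real valued, so that the radius of the empty set is +oo. *)
Definition cover_radius (C : {set S}) : \bar R :=
  \big[maxe/-oo]_(p : S) \big[mine/+oo]_(q in C) (fdist p q)%:E.

End Metric.

Section Matroid.

Record matroid (E : finType) := Matroid {
  indep : {set {set E}};
  indep_set0 : finset.set0 \in indep;
  indep_subset : forall A B : {set E},
    A \subset B -> B \in indep -> A \in indep;
  indep_exchange : forall A B : {set E},
    A \in indep -> B \in indep -> (#|A| < #|B|)%N ->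
    exists2 x, x \in B :\: A & x |: A \in indep }.

Definition is_matroid_rank (E : finType) (M : matroid E) (k : nat) : Prop :=
  forall A, maxset (mem (indep M)) A -> #|A| = k.

(* The maximal independent sets of the restriction of M to X. *)
Definition is_mis (E : finType) (M : matroid E) (X A : {set E}) : bool :=
  maxset [pred B : {set E} | (B \in indep M) && (B \subset X)] A.

Definition opt_radius (R : realType) (U : metricType R) (S : {fset U})
    (M : matroid S) : \bar R :=
  (\big[mine/+oo]_(C in indep M) cover_radius C)%E.

End Matroid.

Section CoverTree.
Variables (R : realType) (X : finType) (d : X -> X -> R).

(* The points of the nodes of a level being distinct, a node is a pair (l, p)
   with p in [ct_level l]; [ct_parent l p] is the point of its parent, which
   lies at level l + 1. Levels extend indefinitely below the root: the first
   condition, at every level, keeps each point forever once it has appeared. *)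
Record cover_tree := CoverTree {
  ct_level : int -> {set X};
  ct_parent : int -> X -> X;
  ct_top : int;
  ct_root : X;
  ct_root_level : ct_root \in ct_level ct_top;
  ct_above_root : forall l, ct_top < l -> ct_level l = finset.set0;
  ct_parent_level : forall l p, p \in ct_level l -> (l, p) != (ct_top, ct_root) ->
    ct_parent l p \in ct_level (l + 1);
  ct_all_points : forall p, exists l, p \in ct_level l;
  ct_nesting : forall l, ct_level l \subset ct_level (l - 1);
  ct_covering : forall l p, p \in ct_level l -> (l, p) != (ct_top, ct_root) ->
    d p (ct_parent l p) <= (2 : R) ^ (l + 1);
  ct_separation : forall l p q, p \in ct_level l -> q \in ct_level l -> p != q ->
    (2 : R) ^ l < d p q }.

Definition ct_children (T : cover_tree) (l : int) (p : X) : {set X} :=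
  [set q in ct_level T (l - 1) | ct_parent T (l - 1) q == p].

Definition only_self_child (T : cover_tree) (l : int) (p : X) : bool :=
  ct_children T l p == [set p].

End CoverTree.

Section ExplicitTree.
Variable X : finType.

(* A node of the explicit representation stands for the nodes of point
   [et_point] at the levels from [et_top] down to [et_bot], [None] meaning that
   there is no lowest level. *)
Inductive etree := ENode {
  et_point : X;
  et_top : int;
  et_bot : option int;
  et_weight : nat;
  et_mis : seq X;
  et_children : seq etree }.

Fixpoint subtree_points (u : etree) : seq X :=
  et_point u :: flatten [seq subtree_points c | c <- et_children u].

Variables (R : realType) (d : X -> X -> R).

(* In the finite case, the condition on levels b and b - 1 says that a chain of
   nodes with only the same-point child is never cut. Whether the node at which
   the chain stops (it has other children, or none) is merged with the chain or
   is kept as a separate child of it is left open. *)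
Inductive explicit_node (T : cover_tree d) : etree -> Prop :=
  ExplicitNode u of
    et_point u \in ct_level T (et_top u) &
    match et_bot u with
    | Some b =>
      [/\ b <= et_top u,
          forall l, b < l <= et_top u -> only_self_child T l (et_point u),
          ~~ (only_self_child T b (et_point u)
              && only_self_child T (b - 1) (et_point u)),
          uniq [seq et_point c | c <- et_children u] /\
          [seq et_point c | c <- et_children u] =i ct_children T b (et_point u)
        & forall c, List.In c (et_children u) -> et_top c = b - 1]
    | None =>
      (forall l, l <= et_top u -> only_self_child T l (et_point u)) /\
      et_children u = [::]
    end &
    (forall c, List.In c (et_children u) -> explicit_node T c) :
  explicit_node T u.

Definition explicit_representation (T : cover_tree d) (u : etree) : Prop :=
  [/\ et_point u = ct_root T, et_top u = ct_top T & explicit_node T u].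

Inductive augmented (M : matroid X) : etree -> Prop :=
  Augmented u of
    et_weight u = #|[set q in subtree_points u]| &
    uniq (et_mis u) &
    is_mis M [set q in subtree_points u] [set q in et_mis u] &
    (forall c, List.In c (et_children u) -> augmented M c) :
  augmented M u.

End ExplicitTree.

(* The computation model: a first-order call-by-value language over immutable
   linked data. Running time is the number of evaluated subterms, a call to the
   metric or to the independence oracle included. Since a program is a fixed
   finite text, each of these steps takes constant time on a pointer machine
   handling integers, reals and points as atomic values. A program does not
   mention the metric space, the points, the matroid or the reals: it reaches
   them only through its inputs and the two oracles. *)

Inductive op1 := Fst | Snd | Indep.

Inductive op2 := Pair | AddI | SubI | LeI | AddR | SubR | LeR | EqP | Dist.

Inductive lit := LNil | LBool of bool | LInt of int | LReal of int.

(* Variables are de Bruijn indices. [Case e e1 e2] tests whether e is the empty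
   list; e2 is evaluated with the head and the tail bound to 0 and 1. [Call f e]
   runs the f-th function of the program with its argument bound to 0. *)
Inductive term :=
| Var of nat
| Lit of lit
| Op1 of op1 & term
| Op2 of op2 & term & term
| If of term & term & term
| Case of term & term & term
| Let of term & term
| Call of nat & term.

Record program := Program { functions : seq term; main : term }.

Section Semantics.
Variables (R : realType) (X : finType).

(* A pair is also a list cell, [VNil] being the empty list. *)
Inductive value :=
| VNil
| VBool of bool
| VInt of int
| VReal of R
| VPoint of X
| VPair of value & value.

Fixpoint enc_seq (s : seq value) : value :=
  if s is v :: s' then VPair v (enc_seq s') else VNil.

Definition enc_points (s : seq X) : value := enc_seq [seq VPoint p | p <- s].

Fixpoint dec_points (v : value) : option (seq X) :=
  match v with
  | VNil => Some [::]
  | VPair (VPoint p) w => omap (cons p) (dec_points w)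
  | _ => None
  end.

Definition enc_level (o : option int) : value :=
  if o is Some l then VPair (VInt l) VNil else VNil.

Fixpoint enc_etree (u : etree X) : value :=
  enc_seq [:: VPoint (et_point u); VInt (et_top u); enc_level (et_bot u);
             VInt (et_weight u)%:Z; enc_points (et_mis u);
             enc_seq [seq enc_etree c | c <- et_children u]].

Variables (d : X -> X -> R) (M : matroid X).

Definition lit_value (c : lit) : value :=
  match c with
  | LNil => VNil
  | LBool b => VBool b
  | LInt z => VInt z
  | LReal z => VReal z%:~R
  end.

Definition op1_value (o : op1) (v : value) : option value :=
  match o, v with
  | Fst, VPair a _ => Some a
  | Snd, VPair _ b => Some b
  | Indep, _ => omap (fun s => VBool ([set p in s] \in indep M)) (dec_points v)
  | _, _ => None
  end.

Definition op2_value (o : op2) (v w : value) : option value :=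
  match o, v, w with
  | Pair, _, _ => Some (VPair v w)
  | AddI, VInt a, VInt b => Some (VInt (a + b))
  | SubI, VInt a, VInt b => Some (VInt (a - b))
  | LeI, VInt a, VInt b => Some (VBool (a <= b))
  | AddR, VReal a, VReal b => Some (VReal (a + b))
  | SubR, VReal a, VReal b => Some (VReal (a - b))
  | LeR, VReal a, VReal b => Some (VBool (a <= b))
  | EqP, VPoint p, VPoint q => Some (VBool (p == q))
  | Dist, VPoint p, VPoint q => Some (VReal (d p q))
  | _, _, _ => None
  end.

(* [eval F env e v t]: with functions F, in the environment env, e evaluates to
   v in time t. The inputs of a program are the initial environment of [main]. *)
Inductive eval (F : seq term) : seq value -> term -> value -> nat -> Prop :=
| EvVar env i v of onth env i = Some v :
    eval F env (Var i) v 1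
| EvLit env c :
    eval F env (Lit c) (lit_value c) 1
| EvOp1 env o e v w t of
    eval F env e v t & op1_value o v = Some w :
    eval F env (Op1 o e) w t.+1
| EvOp2 env o e1 e2 v1 v2 w t1 t2 of
    eval F env e1 v1 t1 & eval F env e2 v2 t2 & op2_value o v1 v2 = Some w :
    eval F env (Op2 o e1 e2) w (t1 + t2).+1
| EvIf env e (b : bool) e1 e2 w t1 t2 of
    eval F env e (VBool b) t1 & eval F env (if b then e1 else e2) w t2 :
    eval F env (If e e1 e2) w (t1 + t2).+1
| EvCaseNil env e e1 e2 w t1 t2 of
    eval F env e VNil t1 & eval F env e1 w t2 :
    eval F env (Case e e1 e2) w (t1 + t2).+1
| EvCasePair env e e1 e2 a b w t1 t2 of
    eval F env e (VPair a b) t1 & eval F [:: a, b & env] e2 w t2 :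
    eval F env (Case e e1 e2) w (t1 + t2).+1
| EvLet env e1 e2 v w t1 t2 of
    eval F env e1 v t1 & eval F (v :: env) e2 w t2 :
    eval F env (Let e1 e2) w (t1 + t2).+1
| EvCall env f e body v w t1 t2 of
    eval F env e v t1 & onth F f = Some body & eval F [:: v] body w t2 :
    eval F env (Call f e) w (t1 + t2).+1.

Definition runs (P : program) (inputs : seq value) (v : value) (t : nat) : Prop :=
  eval (functions P) inputs (main P) v t.

Lemma eval_det F env e v t v' t' :
  eval F env e v t -> eval F env e v' t' -> v = v' /\ t = t'.
Proof.
move=> ev; elim: ev v' t' => {env e v t}; intros;
  repeat match goal with
  | H : eval F ?r ?e ?w ?t, IH : forall v' t', eval F ?r ?e v' t' -> _ |- _ =>
    clear H
  end;
  match goal with ev : eval _ _ _ v' _ |- _ => inversion ev; subst end;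
  repeat match goal with
  | IH : forall v' t', eval F ?r ?e v' t' -> _, ev : eval F ?r ?e _ _ |- _ =>
    let E := fresh in
    destruct (IH _ _ ev) as [E ?]; clear IH ev; try discriminate E; subst;
    try (injection E; clear E; intros; subst)
  | H1 : ?x = Some _, H2 : ?x = Some _ |- _ =>
    rewrite H1 in H2; injection H2; clear H2; intros; subst
  end; by [].
Qed.

End Semantics.

Arguments VNil {R X}.
Arguments VBool {R X}.
Arguments VInt {R X}.
Arguments VReal {R X}.
Arguments VPoint {R X}.
Arguments VPair {R X}.
Arguments enc_points {R X}.
Arguments enc_etree {R X}.

(* Main.v *)
(* Let r* be the optimal radius. Descending the cover tree until a level has
   more than k = rank(M) points stops at a level m with r* >= 2^(m-2), since two
   of these points share a center. The explicit representation skips the levels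
   at which nothing branches, and a branching level b witnesses a distance in
   (2^(b-2), 2^b]; so there are at most log Delta + O(1) rounds, each of cost O(k)
   because the expansion of a level is aborted once it exceeds k nodes.
   Descending j further levels, where 2^j is about 1/eps, gives a level of at
   most k (64/eps)^D nodes whose subtrees have radius delta <= 8 eps r*. The union
   Q of their maximal independent sets contains an independent set of radius
   r* + 2 delta.

   For each distance r between a node and a point of Q, pick greedily node points
   at distance more than 2r (the pivots) and look for an independent set
   hitting the r-ball of every pivot. The balls are disjoint, so this is Rado's
   independent transversal problem, solved by augmenting trails. A trail need not
   be shortest: its last step that can be performed alone is performed first, and
   the remaining prefix is again a trail. The least successful r is at most
   r* + 2 delta, and the transversal found for it has radius at most
   3 r + delta <= (3 + 56 eps) r*. *)

Require Import Defs.
From HB Require Import structures.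
From mathcomp Require Import all_boot all_order all_algebra finmap.
From mathcomp Require Import all_classical all_reals all_analysis.
From mathcomp Require Import zify ring lra fintype finset.

Set Implicit Arguments.
Unset Strict Implicit.
Unset Printing Implicit Defensive.

Import Order.TTheory GRing.Theory Num.Theory.
Local Open Scope ring_scope.

(** * Matroid exchange *)

(** The program receives neither k nor D. The rank enters through the independent set stored at the
    root, spent as a unary budget during the descent. D occurs only in the analysis, and the depth
    of the refinement comes from doubling eps until it reaches 1. Two points shape the time bound.
    The length of a list is often bounded only by correctness: few pivots are reached because the
    recorded trails are valid, and a partial transversal is short because it represents distinct
    pivots. The cost lemmas therefore carry hypotheses of the correctness lemmas. Moreover the
    number j of refinement rounds, about log(1/eps), has to be absorbed by (64/eps)^D, which needs D
    to be at least 1; two distinct points force this, and a set with a single point is answered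
    separately. Completeness of the augmentation rests on saturation: a failed search leaves a set
    of reached pivots closed under exchanges, and the matroid axioms then refute the existence of a
    transversal. *)

Section Matroid.
Local Open Scope nat_scope.
Variables (X : finType) (M : matroid X).
Implicit Types (A B I J : {set X}) (x z : X).

(** Exchange [x |: J] against [z |: I]. The element obtained is either [z], as wanted, or some [w]
    of [I] outside [J]; as [I] has at most one such element, [w |: (x |: J)] would be the dependent
    set [x |: I]. *)
Lemma indep_exchange_swap I J x z :
  J \subset I -> #|I| <= #|J|.+1 -> x \notin I -> z \notin I ->
  z |: I \in indep M -> x |: J \in indep M -> x |: I \notin indep M ->
  x |: (z |: J) \in indep M.
Proof.
move=> sJI cI xI zI zII xJI xII.
have xJ : x \notin J by apply: contra xI => /(subsetP sJI).
have nJI : J != I by apply/eqP => E; move: xII; rewrite -E xJI.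
have cJI : #|J| < #|I|.
  by rewrite ltn_neqAle subset_leq_card // andbT; apply: contra nJI => /eqP E;
     rewrite eqEcard sJI E leqnn.
case: (indep_exchange xJI zII).
  by rewrite !cardsU1 xJ zI /= !add1n ltnS.
move=> w; rewrite !inE negb_or => /andP[/andP[wx wJ]] /orP[/eqP ->|wI].
  by rewrite setUCA.
suff -> : w |: (x |: J) = x |: I by move=> E; rewrite E in xII.
rewrite setUCA; congr (_ :|: _); apply/eqP; rewrite eqEcard subUset sub1set wI sJI /=.
by rewrite cardsU1 wJ add1n.
Qed.

Lemma indep_extend A B :
  A \in indep M -> B \in indep M -> #|A| <= #|B| ->
  exists C : {set X}, [/\ C \in indep M, A \subset C, C \subset A :|: B & #|C| = #|B|].
Proof.
move=> Ai Bi; move E : (#|B| - #|A|) => n.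
elim: n A Ai E => [|n IH] A Ai E le.
  exists A; split; rewrite ?subsetUl //; lia.
have [x] : exists2 x, x \in B :\: A & x |: A \in indep M.
  by apply: indep_exchange => //; lia.
rewrite inE => /andP[xA xB] xAi.
have [||C [Ci AC CU CB]] := IH (x |: A) xAi; rewrite ?cardsU1 ?xA; [lia|lia|].
exists C; split=> //; first exact: subset_trans (subsetUr _ _) AC.
apply: subset_trans CU _.
by rewrite !subUset subsetUl subsetUr sub1set inE xB orbT.
Qed.

(** Extending [x |: A] inside [x |: I] to the size of [I] omits exactly one element [y] of [I], and
    [y] is outside [A] because the extension contains [A]. *)
Lemma indep_replace A I x :
  I \in indep M -> A \subset I -> x \notin I -> x |: A \in indep M ->
  x |: I \notin indep M ->
  exists2 y, y \in I :\: A & x |: (I :\ y) \in indep M.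
Proof.
move=> Ii AI xI xAi xII.
have xA : x \notin A by apply: contra xI => /(subsetP AI).
have cAI : #|A| < #|I|.
  rewrite ltn_neqAle subset_leq_card // andbT; apply: contra xII => /eqP E.
  by have /eqP <- : A == I by rewrite eqEcard AI E leqnn.
have [|C [Ci AC CU CI]] := indep_extend xAi Ii; first by rewrite cardsU1 xA.
have CxI : C \subset x |: I.
  apply: subset_trans CU _.
  by rewrite -setUA (setUidPr AI).
have [y yI yC] : exists2 y, y \in I & y \notin C.
  apply/subsetPn; apply: contra xII => IC.
  suff <- : C = x |: I by [].
  apply/eqP; rewrite eqEsubset CxI subUset IC andbT sub1set.
  by apply: (subsetP AC); rewrite !inE eqxx.
exists y; first by rewrite inE yI andbT; apply: contra yC => yA;
  apply: (subsetP AC); rewrite !inE yA orbT.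
suff <- : C = x |: (I :\ y) by [].
apply/eqP; rewrite eqEcard; apply/andP; split.
  apply/subsetP => w wC; have := subsetP CxI _ wC.
  rewrite !inE => /orP[->//|->]; rewrite andbT orbC.
  by case: eqP wC yC => [->->|].
by rewrite CI cardsU1 !inE (negbTE xI) andbF (cardsD1 y I) yI.
Qed.

Lemma indep_leq_rank k A : is_matroid_rank M k -> A \in indep M -> #|A| <= k.
Proof.
move=> rk Ai; have [B mB AB] := @maxset_exists _ (mem (indep M)) A Ai.
by rewrite -(rk _ mB) subset_leq_card.
Qed.

Lemma mis_sub A B : is_mis M A B -> B \in indep M /\ B \subset A.
Proof. by move=> /maxsetp /= /andP[]. Qed.

(** If [N] is too small for an exchange with [C :\ c], it is first extended from [C] to the size of
    [C]. By maximality of [N] in [Y] the extension cannot contain [c], so the element it gives to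
    [C :\ c] comes from [N]. *)
Lemma mis_replace (Y N C : {set X}) c :
  is_mis M Y N -> c \in Y -> c \in C -> C \in indep M -> c \notin N ->
  exists2 q, q \in N & q |: (C :\ c) \in indep M /\ q \notin C :\ c.
Proof.
move=> mN cY cC Ci cN; have [Ni NY] := mis_sub mN.
have cNi : c |: N \notin indep M.
  apply/negP => cNi.
  have := maxsetsup mN (B := c |: N); rewrite /= cNi subUset sub1set cY NY.
  move=> /(_ isT (subsetUr _ _)) E; move: cN; rewrite -E.
  by rewrite !inE eqxx.
have Di : C :\ c \in indep M by apply: indep_subset Ci; exact: subsetDl.
have cD : #|C| = #|C :\ c|.+1 by rewrite (cardsD1 c) cC.
have [lt|ge] := ltnP #|C :\ c| #|N|.
  by have [q] := indep_exchange Di Ni lt; rewrite inE => /andP[qC qN qi]; exists q.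
have [|C' [C'i NC' C'U cC']] := indep_extend Ni Ci; first by rewrite cD ltnW.
have [|w] := indep_exchange Di C'i; first by rewrite cC' cD.
rewrite inE => /andP[wD wC'] wi; exists w => //.
have := subsetP C'U _ wC'; rewrite inE => /orP[//|wC].
case: (w =P c) => [wc|/eqP wc]; last by rewrite !inE wc wC in wD.
case/negP: cNi; apply: indep_subset C'i.
by rewrite subUset sub1set -wc wC'.
Qed.

End Matroid.

(** * Independent transversals *)

Section Transversal.
Local Open Scope nat_scope.
Variables (X : finType) (M : matroid X) (b : rel X).

(* A partial transversal is a list of pairs of a pivot p and an element of the
   block {x | b p x} that represents it. A trail
   [:: (p_t, x_t); ...; (p_0, x_0)] is an alternating path, latest step first:
   x_i lies in the block of p_i and may be exchanged with the representative of
   p_(i+1). *)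
Implicit Types (I tr : seq (X * X)) (rs : seq (X * seq (X * X))).

Definition ind (s : seq X) : bool := [set x in s] \in indep M.

Definition elems I : seq X := [seq e.2 | e <- I].

Definition del p I := [seq e <- I | e.1 != p].

Definition addable I x := (x \notin elems I) && ind (x :: elems I).

(** Since the latest step is the head of the list, this selects the addable step nearest to the
    uncovered pivot. The steps kept behind it are then not addable, which is what [swap_addable]
    asks of them. *)
Fixpoint last_addable I tr :=
  if tr is e :: tr' then
    if last_addable I tr' is e' :: tr'' then e' :: tr''
    else if addable I e.2 then e :: tr' else [::]
  else [::].

(** [n] is fuel for the structural recursion; every round shortens the trail, so its length is
    enough. *)
Fixpoint apply_trail n I tr :=
  if n is n'.+1 then
    if last_addable I tr is e :: tr' then apply_trail n' (e :: del e.1 I) tr'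
    else I
  else I.

Definition swaps I p x tr rs (l : seq (X * X)) :=
  foldr (fun e acc =>
    if e.1 \in [seq nd.1 | nd <- acc] then acc
    else if ind (x :: elems (del e.1 I)) then (e.1, (p, x) :: tr) :: acc
    else acc) rs l.

Definition reach_from I p tr rs (Q : seq X) :=
  foldr (fun x acc =>
    if b p x && (x \notin elems I) then swaps I p x tr acc I else acc) rs Q.

Definition reach_step I Q rs (l : seq (X * seq (X * X))) :=
  foldr (fun nd acc => reach_from I nd.1 nd.2 acc Q) rs l.

Definition reach I Q p0 (fuel : seq (X * X)) :=
  foldr (fun _ rs => reach_step I Q rs rs) [:: (p0, [::])] fuel.

Definition finish I p tr (Q : seq X) : seq (X * X) :=
  foldr (fun x acc => if b p x && addable I x then (p, x) :: tr else acc) [::] Q.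

Definition find_trail I Q rs : seq (X * X) :=
  foldr (fun nd acc => if finish I nd.1 nd.2 Q is e :: w then e :: w else acc)
    [::] rs.

Definition augment_step Q p (o : option (seq (X * X))) :=
  if o is Some J then
    if find_trail J Q (reach J Q p J) is e :: w
    then Some (apply_trail (size (e :: w)) J (e :: w)) else None
  else None.

Definition augment Q (piv : seq X) := foldr (augment_step Q) (Some [::]) piv.

Definition transversal (P : seq X) I :=
  [/\ uniq [seq e.1 | e <- I], [seq e.1 | e <- I] =i P,
      {in I, forall e, b e.1 e.2} & ind (elems I)].

(* A trail that leads from the uncovered pivot p0 to p, whose representative
   its last step can replace. *)
Fixpoint valid_trail I p0 p tr :=
  if tr is e :: tr' then
    [&& p \in [seq e.1 | e <- I], p \notin [seq e.1 | e <- tr], b e.1 e.2,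
        e.2 \notin elems I, ind (e.2 :: elems (del p I))
      & valid_trail I p0 e.1 tr']
  else p == p0.

(** The last clause keeps the pivots of a recorded trail among the reached ones, so a trail extended
    to a new pivot never visits a pivot twice. *)
Definition valid_reach I p0 rs :=
  [/\ uniq [seq nd.1 | nd <- rs],
      {subset [seq nd.1 | nd <- rs] <= p0 :: [seq e.1 | e <- I]} &
      forall nd, nd \in rs -> valid_trail I p0 nd.1 nd.2 /\
        {subset [seq e.1 | e <- nd.2] <= [seq nd.1 | nd <- rs]}].

Definition extends rs rs' :=
  exists l : seq (X * seq (X * X)), rs' = l ++ rs.

Lemma extends_refl rs : extends rs rs. Proof. by exists [::]. Qed.

Lemma extends_trans rs2 rs1 rs3 : extends rs1 rs2 -> extends rs2 rs3 -> extends rs1 rs3.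
Proof. by move=> [l ->] [l' ->]; exists (l' ++ l); rewrite catA. Qed.

Lemma extends_sub rs rs' : extends rs rs' -> {subset rs <= rs'}.
Proof. by move=> [l ->] x xr; rewrite mem_cat xr orbT. Qed.

Lemma extends_size rs rs' : extends rs rs' -> rs' = rs \/ size rs < size rs'.
Proof. by move=> [[|a l] ->]; [left | right; rewrite size_cat /=; lia]. Qed.

Lemma swaps_extends I p x tr rs l : extends rs (swaps I p x tr rs l).
Proof.
elim: l => [|e l IH]; first exact: extends_refl.
rewrite /swaps /= -/(swaps I p x tr rs l).
by case: ifP => // _; case: ifP => // _; apply: extends_trans IH _; exists [:: (e.1, (p, x) :: tr)].
Qed.

Lemma reach_from_extends I p tr rs Q : extends rs (reach_from I p tr rs Q).
Proof.
elim: Q => [|x Q IH]; first exact: extends_refl.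
rewrite /reach_from /= -/(reach_from I p tr rs Q).
by case: ifP => // _; apply: extends_trans IH (swaps_extends _ _ _ _ _ _).
Qed.

Lemma reach_step_extends I Q rs l : extends rs (reach_step I Q rs l).
Proof.
elim: l => [|nd l IH]; first exact: extends_refl.
by apply: extends_trans IH (reach_from_extends _ _ _ _ _).
Qed.

Lemma swaps_valid I p0 p x tr rs l :
  {subset l <= I} -> b p x -> x \notin elems I -> p \in [seq nd.1 | nd <- rs] ->
  valid_trail I p0 p tr -> {subset [seq e.1 | e <- tr] <= [seq nd.1 | nd <- rs]} ->
  valid_reach I p0 rs -> valid_reach I p0 (swaps I p x tr rs l).
Proof.
move=> + bpx xI prs vtr trs vrs.
elim: l => [//|e l IH] lI; rewrite /swaps /= -/(swaps I p x tr rs l).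
have /IH vl : {subset l <= I} by move=> y yl; apply: lI; rewrite inE yl orbT.
case: ifP => // /negP enl; case: ifP => // sw; case: vl => ul sl vl.
have ext : {subset [seq nd.1 | nd <- rs] <= [seq nd.1 | nd <- swaps I p x tr rs l]}.
  move=> y /mapP[nd ndr ->]; apply: map_f.
  exact: (extends_sub (swaps_extends I p x tr rs l)).
have eI : e.1 \in [seq e.1 | e <- I] by apply: map_f; apply: lI; rewrite inE eqxx.
split=> /=.
- by rewrite ul andbT; apply/negP.
- by move=> y; rewrite inE => /orP[/eqP ->|/sl//]; rewrite inE eI orbT.
move=> nd; rewrite inE => /orP[/eqP ->|ndl] /=; last first.
  have [? sub] := vl _ ndl; split=> // y /sub; rewrite inE => ->.
  by rewrite orbT.
rewrite eI bpx xI sw vtr /= !andbT; split.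
  apply/negP; rewrite inE => /orP[/eqP E|/trs/ext //].
  by apply: enl; rewrite E; exact: ext.
move=> y; rewrite !inE => /orP[/eqP ->|/trs/ext ->]; last by rewrite orbT.
by rewrite ext ?orbT.
Qed.

Lemma reach_from_valid I p0 p tr rs Q :
  p \in [seq nd.1 | nd <- rs] ->
  valid_trail I p0 p tr -> {subset [seq e.1 | e <- tr] <= [seq nd.1 | nd <- rs]} ->
  valid_reach I p0 rs -> valid_reach I p0 (reach_from I p tr rs Q).
Proof.
move=> prs vtr trs vrs; elim: Q => [//|x Q IH].
rewrite /reach_from /= -/(reach_from I p tr rs Q).
case: ifP => // /andP[bpx xI].
have ext : {subset [seq nd.1 | nd <- rs] <= [seq nd.1 | nd <- reach_from I p tr rs Q]}.
  move=> y /mapP[nd ndr ->]; apply: map_f.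
  exact: (extends_sub (reach_from_extends I p tr rs Q)).
by apply: swaps_valid => //; [exact: ext | move=> y /trs/ext].
Qed.

Lemma reach_step_valid I p0 Q rs l :
  {subset l <= rs} -> valid_reach I p0 rs -> valid_reach I p0 (reach_step I Q rs l).
Proof.
move=> + vrs; elim: l => [//|nd l IH] lrs; rewrite /reach_step /= -/(reach_step I Q rs l).
have ndr : nd \in rs by apply: lrs; rewrite inE eqxx.
have ext : {subset [seq nd.1 | nd <- rs] <= [seq nd.1 | nd <- reach_step I Q rs l]}.
  move=> y /mapP[nd' ndr' ->]; apply: map_f.
  exact: (extends_sub (reach_step_extends I Q rs l)).
case: (vrs) => _ _ /(_ _ ndr) [vt sub].
apply: reach_from_valid => //; first by apply: ext; apply: map_f.
  by move=> y /sub/ext.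
by apply: IH => y yl; apply: lrs; rewrite inE yl orbT.
Qed.

Lemma reach_valid I Q p0 l : valid_reach I p0 (reach I Q p0 l).
Proof.
elim: l => [|e l IH] /=; last exact: reach_step_valid.
split=> //= [y|nd]; rewrite inE => /eqP ->; first by rewrite inE eqxx.
by split => //=.
Qed.

Lemma valid_reach_size I p0 rs : valid_reach I p0 rs -> size rs <= (size I).+1.
Proof.
case=> u sub _; rewrite -(size_map fst rs) -[X in _ <= X.+1](size_map fst I).
exact: (uniq_leq_size u sub).
Qed.

Lemma valid_trail_uniq I p0 p tr :
  valid_trail I p0 p tr -> uniq (p :: [seq e.1 | e <- tr]).
Proof.
elim: tr p => //= e tr IH p /and5P[_ pn _ _ /andP[_ /IH /=]].
by rewrite pn.
Qed.

Definition reach_closed I (Q : seq X) rs :=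
  forall nd x e, nd \in rs -> x \in Q -> b nd.1 x -> x \notin elems I ->
    e \in I -> ind (x :: elems (del e.1 I)) -> e.1 \in [seq nd.1 | nd <- rs].

Lemma swaps_closed I p x tr rs l e :
  e \in l -> ind (x :: elems (del e.1 I)) ->
  e.1 \in [seq nd.1 | nd <- swaps I p x tr rs l].
Proof.
move=> + sw; elim: l => [//|e' l IH]; rewrite inE /swaps /= -/(swaps I p x tr rs l).
case/orP => [/eqP <-|/IH {}IH].
  case: ifP => // _; rewrite sw; by rewrite /= inE eqxx.
by case: ifP => // _; case: ifP => // _; rewrite /= inE IH orbT.
Qed.

(** A round processes every recorded pivot and never removes one, so each possible exchange ends up
    recorded; if the round changes nothing, it was recorded before. *)
Lemma reach_step_fixed I Q rs : reach_step I Q rs rs = rs -> reach_closed I Q rs.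
Proof.
move=> E nd x e ndr xQ bx xI eI sw; rewrite -E.
suff H l : nd \in l -> e.1 \in [seq nd.1 | nd <- reach_step I Q rs l] by exact: H.
elim: l => [//|nd' l IH]; rewrite inE /reach_step /= -/(reach_step I Q rs l).
have mono rs1 rs2 : extends rs1 rs2 -> e.1 \in [seq nd.1 | nd <- rs1] ->
    e.1 \in [seq nd.1 | nd <- rs2].
  by move=> ex /mapP[nd1 n1 ->]; apply: map_f; apply: (extends_sub ex).
case/orP => [/eqP <-|/IH]; last by apply: mono; exact: reach_from_extends.
clear E IH; move: (reach_step I Q rs l) => rs'; elim: Q xQ => [//|y Q IHQ]; rewrite inE /reach_from /= -/(reach_from _ _ _ _ Q).
case/orP => [/eqP <-|/IHQ H]; first by rewrite bx xI; exact: swaps_closed.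
by case: ifP => // _; apply: mono H; exact: swaps_extends.
Qed.

(** A round that is not stationary reaches a new pivot, and at most [(size I).+1] pivots can be
    reached. Starting from one pivot, [size I] rounds therefore end in a fixed point. *)
Lemma reach_closedP I Q p0 : reach_closed I Q (reach I Q p0 I).
Proof.
pose step rs := reach_step I Q rs rs.
have grow l : step (reach I Q p0 l) = reach I Q p0 l \/ size l < size (reach I Q p0 l).
  elim: l => [|e l IH] /=; first by right.
  rewrite -/(step (reach I Q p0 l)).
  have [E|lt] := extends_size (reach_step_extends I Q (reach I Q p0 l) (reach I Q p0 l)).
    by left; rewrite /step !E.
  case: IH => [E|lt2]; first by rewrite E; left.
  by right; rewrite /step; lia.
apply: reach_step_fixed; case: (grow I) => // lt.
case: (extends_size (reach_step_extends I Q (reach I Q p0 I) (reach I Q p0 I))) => // lt2.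
have := valid_reach_size (reach_step_valid (rs := reach I Q p0 I) Q (fun _ h => h) (reach_valid I Q p0 I)).
lia.
Qed.

Lemma finishP I p tr (Q : seq X) w :
  finish I p tr Q = w -> w <> [::] ->
  exists x, [/\ w = (p, x) :: tr, x \in Q, b p x & addable I x].
Proof.
elim: Q w => [|x Q IH] w /=; first by move=> <-.
case: ifP => [/andP[bx ax] <- _|_ E n0].
  by exists x; rewrite inE eqxx.
have [y [-> yQ ? ?]] := IH _ E n0; exists y; split=> //.
by rewrite inE yQ orbT.
Qed.

Lemma finish_nil I p tr (Q : seq X) x :
  finish I p tr Q = [::] -> x \in Q -> b p x -> ~~ addable I x.
Proof.
elim: Q => [//|y Q IH] /=; case: ifP => // /negbT; rewrite negb_and inE.
move=> nb E /orP[/eqP -> by_|/(IH E) //].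
by case/orP: nb => //; rewrite by_.
Qed.

Lemma find_trailP I (Q : seq X) rs w :
  find_trail I Q rs = w -> w <> [::] ->
  exists nd x, [/\ nd \in rs, w = (nd.1, x) :: nd.2, x \in Q, b nd.1 x & addable I x].
Proof.
elim: rs w => [|nd rs IH] w /=; first by move=> <-.
case E : finish => [|e w'] Ew n0.
  have [nd' [x [? ? ? ? ?]]] := IH _ Ew n0; exists nd', x.
  by split=> //; rewrite inE orbC; apply/orP; left.
have [//|x [Ex ? ? ?]] := finishP E; exists nd, x; split=> //.
  by rewrite inE eqxx.
by rewrite -Ew.
Qed.

Lemma find_trail_nil I (Q : seq X) rs nd x :
  find_trail I Q rs = [::] -> nd \in rs -> x \in Q -> b nd.1 x -> ~~ addable I x.
Proof.
elim: rs => [//|nd' rs IH] /=; rewrite inE; case E : finish => [|e w'] // Ew.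
by case/orP => [/eqP ->|]; [exact: finish_nil E | exact: IH].
Qed.

Lemma last_addable_cat I tr :
  match last_addable I tr with
  | [::] => {in tr, forall e, ~~ addable I e.2}
  | e :: tr' => [/\ exists l, tr = l ++ e :: tr', addable I e.2
                & {in tr', forall e, ~~ addable I e.2}]
  end.
Proof.
elim: tr => [//|e tr] /=; case: last_addable => [|e' tr'].
  by move=> H; case: ifP => [a|/negbT na]; [split=> //; exists [::] |
    move=> y; rewrite inE => /orP[/eqP ->|/H]].
by case=> [[l ->] a H]; split=> //; exists (e :: l).
Qed.

Lemma valid_trail_suffix I p0 p l e tr :
  valid_trail I p0 p (l ++ e :: tr) -> valid_trail I p0 e.1 tr /\ b e.1 e.2.
Proof.
elim: l p => [|e' l IH] p /=; first by case/and5P => _ _ ? _ /andP[].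
by case/and5P => _ _ _ _ /andP[_ /IH].
Qed.

Lemma ind_sub s s' : {subset s <= s'} -> ind s' -> ind s.
Proof.
move=> E; rewrite /ind; apply: (@indep_subset _ M [set x in s] [set x in s']).
by apply/subsetP => x; rewrite !inE => /E.
Qed.

Lemma set_cons (x : X) (s : seq X) : [set y in x :: s] = x |: [set y in s].
Proof. by apply/setP => y; rewrite !inE. Qed.

Lemma mem_elems_del I p x :
  reflect (exists2 e, e \in I & e.1 != p /\ e.2 = x) (x \in elems (del p I)).
Proof.
apply: (iffP mapP) => [[e]|[e eI [n <-]]].
  by rewrite mem_filter => /andP[n eI] ->; exists e.
by exists e => //; rewrite mem_filter n eI.
Qed.

Lemma elems_del_sub I p : {subset elems (del p I) <= elems I}.
Proof. by move=> x /mem_elems_del[e eI [_ <-]]; exact: map_f. Qed.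

Lemma del_fst I p : [seq e.1 | e <- del p I] = [seq q <- [seq e.1 | e <- I] | q != p].
Proof. by rewrite /del filter_map. Qed.

Lemma size_del I p : uniq [seq e.1 | e <- I] -> size I <= (size (del p I)).+1.
Proof.
rewrite /del size_filter; elim: I => [//|e I IH] /= /andP[n u].
case: (e.1 =P p) => [E|_] /=; last by rewrite add1n !ltnS; exact: IH u.
suff -> : count (fun e => e.1 != p) I = size I by lia.
rewrite -size_filter; congr size; apply/all_filterP/allP => y yI.
by apply: contra n => /eqP Ey; rewrite E -Ey map_f.
Qed.

Variable piv : seq X.
Hypothesis disj : forall p q x, p \in piv -> q \in piv -> b p x -> b q x -> p = q.

Lemma transversal_inj P I e e' :
  {subset P <= piv} -> transversal P I -> e \in I -> e' \in I -> e.2 = e'.2 -> e = e'.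
Proof.
move=> sub [u E bI _] eI e'I E2.
have E1 : e.1 = e'.1.
  apply: (@disj _ _ e.2); [| |exact: bI |by rewrite E2; exact: bI];
  by apply: sub; rewrite -E map_f.
by rewrite (surjective_pairing e) (surjective_pairing e') E1 E2.
Qed.

Lemma transversal_elems_uniq P I :
  {subset P <= piv} -> transversal P I -> uniq (elems I).
Proof.
move=> sub tr; case: (tr) => u _ _ _; rewrite map_inj_in_uniq; first exact: map_uniq u.
by move=> e e' eI e'I; exact: (transversal_inj sub tr).
Qed.

Lemma transversal_size P I : uniq P -> transversal P I -> size I = size P.
Proof.
move=> uP [u E _ _]; rewrite -(size_map fst I); apply/eqP.
by rewrite eqn_leq !uniq_leq_size // => x; rewrite E.
Qed.

(* The exchange that keeps the rest of a trail valid after its last usable step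
   is performed. *)
Lemma swap_addable P I p x z :
  {subset P <= piv} -> transversal P I ->
  addable I z -> x \notin elems I -> ~~ addable I x ->
  ind (x :: elems (del p I)) -> ind (x :: z :: elems (del p I)).
Proof.
move=> sub tr /andP[zI zind] xI; rewrite /addable xI /= => xind sw.
have uI : uniq (elems I) := transversal_elems_uniq sub tr.
have uD : uniq (elems (del p I)).
  by apply: subseq_uniq uI; apply: map_subseq; exact: filter_subseq.
rewrite /ind !set_cons; apply: (indep_exchange_swap (I := [set y in elems I])).
- by apply/subsetP => y; rewrite !inE => /elems_del_sub.
- rewrite !cardsE !(card_uniqP _) // !size_map; apply: size_del.
  by case: tr.
- by rewrite inE.
- by rewrite inE.
- by rewrite -set_cons.
- by rewrite -set_cons.
- by rewrite -set_cons.
Qed.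

Lemma upd_transversal P I p x :
  transversal P I -> b p x -> ind (x :: elems (del p I)) ->
  transversal (p :: P) ((p, x) :: del p I).
Proof.
case=> u E bI iI bpx ix; split=> //=.
- by rewrite del_fst mem_filter eqxx /= filter_uniq.
- move=> y; rewrite !inE del_fst mem_filter E.
  by case: eqP.
- move=> e; rewrite inE => /orP[/eqP ->//|]; rewrite mem_filter => /andP[_]; exact: bI.
Qed.

(** No step of the remaining trail is addable in [I], so [swap_addable] lets each exchange survive
    the arrival of [x]. Disjointness of the blocks keeps [x] apart from the elements of the
    trail. *)
Lemma valid_trail_upd P I p0 p x q tr :
  {subset P <= piv} -> p0 \in piv -> transversal P I -> p \in P ->
  addable I x -> b p x -> {in tr, forall e, ~~ addable I e.2} ->
  p \notin q :: [seq e.1 | e <- tr] -> q \in p0 :: P ->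
  valid_trail I p0 q tr -> valid_trail ((p, x) :: del p I) p0 q tr.
Proof.
move=> sub p0v trI pP ax bpx; case: (trI) => u E bI iI.
elim: tr q => [//|e tr IH] q na /= pn qP /and5P[qI qn be eI /andP[sw vt]].
have [pq pe] : p != q /\ p != e.1.
  by move: pn; rewrite !inE !negb_or => /and3P[].
have ePP : e.1 \in p0 :: P.
  by case: tr vt {IH na pn qn} => [/eqP ->|e' tr' /= /and5P[]];
    rewrite ?inE ?eqxx // E => ->; rewrite orbT.
have ev : e.1 \in piv by move: ePP; rewrite inE => /orP[/eqP ->|/sub].
have ex : e.2 != x.
  apply: contra pe => /eqP E2; apply/eqP; apply: (@disj _ _ x) => //; first exact: sub.
  by rewrite -E2.
apply/and5P; split=> //.
- by rewrite inE eq_sym (negbTE pq) /= del_fst mem_filter eq_sym pq qI.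
- by rewrite inE (negbTE ex) /=; apply: contra eI => /elems_del_sub.
apply/andP; split; last first.
  apply: IH => //; first by move=> y yt; apply: na; rewrite inE yt orbT.
  by move: pn; rewrite !inE negb_or => /andP[].
have := swap_addable sub trI ax eI (na e (mem_head _ _)) sw.
apply: ind_sub => y; rewrite !inE /= pq /= inE => /orP[->//|/orP[->|]].
  by rewrite orbT.
case/mem_elems_del => e'; rewrite mem_filter => /andP[_ e'I] [n <-].
rewrite orbC -orbA; apply/orP; right; apply/orP; left.
by apply/mem_elems_del; exists e'.
Qed.

(** The invariant is that the trail has an addable step. Performing a step drops the representative
    that the next step towards [p0] was allowed to replace, and by [swap_addable] that next step
    becomes addable. *)
Lemma apply_trail_transversal n P I p0 p x tr :
  {subset P <= piv} -> p0 \in piv -> p0 \notin P -> transversal P I ->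
  size tr < n -> b p x -> p \in p0 :: P -> valid_trail I p0 p tr ->
  has (fun e => addable I e.2) ((p, x) :: tr) ->
  transversal (p0 :: P) (apply_trail n I ((p, x) :: tr)).
Proof.
move=> sub p0v p0P.
elim: n I p x tr => [//|n IH] I p x tr trI lt bpx pP vt /hasP[e0 e0in a0].
cbn [apply_trail]; have := last_addable_cat I ((p, x) :: tr).
case: last_addable => [/(_ _ e0in)|e rest [[l El] ae na]]; first by rewrite a0.
have [u E bI iI] := trI.
have [vr be] : valid_trail I p0 e.1 rest /\ b e.1 e.2.
  case: l El => [[<- <-]//|e' l [_ E2]]; rewrite E2 in vt.
  exact: valid_trail_suffix vt.
have sr : size rest < n.+1.
  have /= := congr1 size El; rewrite size_cat /=; lia.
case/andP: (ae) => e2I e2ind.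
have i' : ind (e.2 :: elems (del e.1 I)).
  by apply: ind_sub e2ind => y; rewrite !inE => /orP[->//|/elems_del_sub ->]; rewrite orbT.
have tr' := upd_transversal trI be i'.
rewrite (surjective_pairing e) /= in tr' *.
(* If nothing remains, the step belongs to [p0] and the transversal gains this pivot. Otherwise
   [e.1] was already covered and only its representative changes. *)
case: rest vr na sr {El} => [/eqP Ep _ _|[q x'] rest /= /and5P[pI pn bq x'I /andP[sw vq]] na sr].
  by rewrite -Ep; case: (n).
have pP' : e.1 \in P by rewrite -E.
apply: IH => //.
- case: tr' => u' E' ? ?; split=> // y; rewrite E' inE.
  by case: eqP => // ->; rewrite pP'.
- case: rest vq {na pn sr} => [/eqP ->|e' tr'' /= /and5P[]]; rewrite ?inE ?eqxx // E => ->.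
  by rewrite orbT.
- apply: (valid_trail_upd sub p0v trI) => //.
    by move=> y yr; apply: na; rewrite inE yr orbT.
  case: rest vq {na pn sr} => [/eqP ->|e' tr'' /= /and5P[]]; rewrite ?inE ?eqxx // E => ->.
  by rewrite orbT.
apply/hasP; exists (q, x'); first by rewrite inE eqxx.
have nx : ~~ addable I x' by apply: (na (q, x')); rewrite inE eqxx.
have qv : q \in piv.
  case: rest vq {na pn sr} => [/eqP ->//|e' tr'' /= /and5P[]]; rewrite E => /sub //.
rewrite /addable /=; apply/andP; split.
  rewrite inE negb_or; apply/andP; split; last by apply: contra x'I => /elems_del_sub.
  apply: contra pn => /eqP E2; rewrite inE; apply/orP; left; apply/eqP.
  apply: (@disj _ _ x') => //; [exact: sub | by rewrite E2].
exact: (swap_addable sub trI ae x'I nx sw).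
Qed.

Lemma augment_sound Q P :
  uniq P -> {subset P <= piv} -> forall I, augment Q P = Some I -> transversal P I.
Proof.
elim: P => [|p0 P IH] /=.
  move=> _ _ I [<-]; split=> //; rewrite /ind.
  suff -> : [set x in elems [::]] = set0 :> {set X} by exact: indep_set0.
  by apply/setP => x; rewrite !inE.
case/andP => p0P uP sub I; rewrite /augment_step -/(augment Q P).
have subP : {subset P <= piv} by move=> y yP; apply: sub; rewrite inE yP orbT.
case E : augment => [J|//]; have tJ := IH uP subP J E.
case Ef : find_trail => [//|e w] /Some_inj <-.
have [//|nd [x [ndr [-> ->] xQ bx ax]]] := find_trailP Ef.
have [_ sr vr] := reach_valid J Q p0 J.
have [vt _] := vr _ ndr.
apply: (@apply_trail_transversal _ P J p0) => //.
- by apply: sub; rewrite inE eqxx.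
- have := sr _ (map_f fst ndr); rewrite !inE => /orP[->//|].
  by case: tJ => _ -> _ _ ->; rewrite orbT.
- by rewrite /= ax.
Qed.

(** Suppose the search from [p0] fails, with reached pivots [A]. The part of [J] over [A] is smaller
    than the independent image of [A] under [f], so it can be extended by some [x = f p]. As [x] is
    not addable to [J], [indep_replace] exchanges it for a representative of a pivot outside [A];
    but closure of the search would have reached that pivot. *)
Lemma augment_complete (Q : seq X) (f : X -> X) :
  uniq piv -> {in piv, forall p, f p \in Q /\ b p (f p)} -> ind [seq f p | p <- piv] ->
  augment Q piv <> None.
Proof.
move=> up fP fI.
suff H P : uniq P -> {subset P <= piv} -> augment Q P <> None by exact: H.
elim: P => [//|p0 P IH] /= /andP[p0P uP] sub; rewrite /augment_step -/(augment Q P).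
have subP : {subset P <= piv} by move=> y yP; apply: sub; rewrite inE yP orbT.
case E : augment => [J|]; last by case: (IH uP subP E).
have tJ := augment_sound uP subP E.
case Ef : find_trail => [|//] _.
set rs := reach J Q p0 J in Ef.
have na nd x : nd \in rs -> x \in Q -> b nd.1 x -> ~~ addable J x.
  exact: find_trail_nil Ef.
have cl : reach_closed J Q rs := @reach_closedP J Q p0.
have [ur sr _] := reach_valid J Q p0 J; rewrite -/rs in ur sr.
case: (tJ) => uJ EJ bJ iJ.
have p0r : p0 \in [seq nd.1 | nd <- rs].
  suff H l : p0 \in [seq nd.1 | nd <- reach J Q p0 l] by exact: H.
  elim: l => [|e l IHl]; first by rewrite inE eqxx.
  case/mapP: IHl => nd ndr Ep; rewrite [X in X \in _]Ep; apply: map_f.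
  exact: (extends_sub (reach_step_extends J Q (reach J Q p0 l) (reach J Q p0 l)) ndr).
set A := [seq nd.1 | nd <- rs] in ur sr p0r.
have sA : {subset A <= piv}.
  by move=> y /sr; rewrite inE => /orP[/eqP ->|]; [apply: sub; rewrite inE eqxx | rewrite EJ => /subP].
have fA : [set f p | p in A] \in indep M.
  apply: indep_subset fI; apply/subsetP => y /imsetP[p pA ->].
  by rewrite inE; apply: map_f; exact: sA.
have finj : {in A &, injective f}.
  move=> p q pA qA Epq; apply: (@disj p q (f p)); rewrite ?sA //.
    by case: (fP _ (sA _ pA)).
  by rewrite Epq; case: (fP _ (sA _ qA)).
pose JA := [seq e <- J | e.1 \in A].
have JAJ : {subset elems JA <= elems J}.
  by move=> y /mapP[e]; rewrite mem_filter => /andP[_ eJ] ->; exact: map_f.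
have iJA : ind (elems JA) by exact: ind_sub iJ.
(* The inequality is strict because [p0] is reached but has no representative. *)
have cJA : #|[set y in elems JA]| < #|[set f p | p in A]|.
  rewrite card_in_imset // cardsE (card_uniqP ur).
  apply: leq_ltn_trans (card_size _) _; rewrite size_map -(size_map fst).
  have : size (p0 :: [seq e.1 | e <- JA]) <= size A; last by [].
  apply: uniq_leq_size.
    have -> : [seq e.1 | e <- JA] = [seq q <- [seq e.1 | e <- J] | q \in A].
      by rewrite filter_map.
    by rewrite /= filter_uniq // andbT mem_filter EJ (negbTE p0P) andbF.
  move=> y; rewrite inE => /orP[/eqP -> //|/mapP[e]].
  by rewrite mem_filter => /andP[? _] ->.
have [x] := indep_exchange iJA fA cJA.
rewrite !inE => /andP[xJA /imsetP[p pA Ex]] xi.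
have [xQ bx] : x \in Q /\ b p x by rewrite Ex; apply: fP; exact: sA.
have /mapP[nd ndr Ep] := pA.
have nax : ~~ addable J x by apply: (na nd) => //; rewrite -Ep.
have xJ : x \notin elems J.
  apply: contra xJA => /mapP[e eJ E2]; rewrite E2; apply: map_f.
  rewrite mem_filter eJ andbT.
  suff -> : e.1 = p by [].
  apply: (@disj _ _ x); [|exact: sA|rewrite E2; exact: bJ|by []].
  by apply: subP; rewrite -EJ map_f.
have xi' : x |: [set y in elems J] \notin indep M.
  by move: nax; rewrite /addable xJ /ind set_cons.
have xnJ : x \notin [set y in elems J] by rewrite inE.
have JAJs : [set y in elems JA] \subset [set y in elems J].
  by apply/subsetP => y; rewrite !inE => /JAJ.
have [y] := indep_replace iJ JAJs xnJ xi xi'.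
rewrite !inE => /andP[yJA /mapP[e eJ Ey]] swy.
have : e.1 \in A.
  apply: (cl nd x) => //; first by rewrite -Ep.
  apply: indep_subset swy; apply/subsetP => w; rewrite !inE => /orP[->//|].
  case/mem_elems_del => e' e'J [n <-]; apply/orP; right; rewrite map_f // andbT.
  rewrite Ey; apply: contra n => /eqP E2.
  by rewrite (transversal_inj subP tJ e'J eJ E2).
by move=> eA; move: yJA; rewrite Ey map_f // mem_filter eA.
Qed.

End Transversal.

(** * The program *)

(* Positions of the functions in [functions_text]. *)
Definition memfst_f := 0%N.
Definition memsnd_f := 1%N.
Definition elems_f := 2%N.
Definition del_f := 3%N.
Definition addable_f := 4%N.
Definition last_addable_f := 5%N.
Definition apply_f := 6%N.
Definition swaps_f := 7%N.
Definition reach_from_f := 8%N.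
Definition reach_step_f := 9%N.
Definition reach_f := 10%N.
Definition finish_f := 11%N.
Definition find_trail_f := 12%N.
Definition augment_f := 13%N.
Definition near_f := 14%N.
Definition far_f := 15%N.
Definition best_for_f := 16%N.
Definition best_f := 17%N.
Definition app_f := 18%N.
Definition all_mis_f := 19%N.
Definition points_f := 20%N.
Definition max_bot_f := 21%N.
Definition nexts_f := 22%N.
Definition take_f := 23%N.
Definition expand_f := 24%N.
Definition coarse_f := 25%N.
Definition down_f := 26%N.
Definition refine_f := 27%N.

Section Program.
Local Open Scope nat_scope.
Local Notation "# n" := (Var n) (at level 1, format "# n").
Local Notation fst_ := (Op1 Fst).
Local Notation snd_ := (Op1 Snd).
Local Notation "<< x ; y >>" := (Op2 Pair x y).
Local Notation nil_ := (Lit LNil).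
Local Notation true_ := (Lit (LBool true)).
Local Notation false_ := (Lit (LBool false)).
Local Notation bot_of u := (fst_ (snd_ (snd_ u))).
Local Notation weight_of u := (fst_ (snd_ (snd_ (snd_ u)))).
Local Notation mis_of u := (fst_ (snd_ (snd_ (snd_ (snd_ u))))).
Local Notation children_of u := (fst_ (snd_ (snd_ (snd_ (snd_ (snd_ u)))))).

(* The argument of f is a pair (parameter, list). In [base] it is variable 0; in
   [step], variables 0 to 3 are the result on the tail, the head, the tail and
   the argument. *)
Definition fold_body f base step :=
  Case (snd_ #0) base (Let (Call f <<fst_ #2; #1>>) step).

Definition memfst_b := fold_body memfst_f false_
  (If (Op2 EqP (fst_ #1) (fst_ #3)) true_ #0).

Definition memsnd_b := fold_body memsnd_f false_
  (If (Op2 EqP (snd_ #1) (fst_ #3)) true_ #0).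

Definition elems_b := fold_body elems_f nil_ <<snd_ #1; #0>>.

Definition del_b := fold_body del_f nil_
  (If (Op2 EqP (fst_ #1) (fst_ #3)) #0 <<#1; #0>>).

Definition addable_b :=
  If (Call memsnd_f #0) false_
    (Op1 Indep <<fst_ #0; Call elems_f <<nil_; snd_ #0>> >>).

Definition last_addable_b := fold_body last_addable_f nil_
  (Case #0 (If (Call addable_f <<snd_ #1; fst_ #3>>) <<#1; #2>> nil_) <<#0; #1>>).

Definition apply_b :=
  Case (Call last_addable_f #0) (fst_ #0)
    (Call apply_f << <<#0; Call del_f <<fst_ #0; fst_ #2>> >>; #1>>).

Definition swaps_b := fold_body swaps_f (fst_ (fst_ #0))
  (If (Call memfst_f <<fst_ #1; #0>>) #0
    (If (Op1 Indep <<snd_ (fst_ (snd_ (snd_ (fst_ #3))));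
           Call elems_f <<nil_; Call del_f <<fst_ #1; fst_ (snd_ (fst_ #3))>> >> >>)
      << <<fst_ #1; snd_ (snd_ (fst_ #3))>>; #0>> #0)).

Definition reach_from_b := fold_body reach_from_f (fst_ (fst_ #0))
  (If (Op2 LeR (Op2 Dist (fst_ (fst_ (snd_ (fst_ #3)))) #1) (snd_ (snd_ (snd_ (fst_ #3)))))
    (If (Call memsnd_f <<#1; fst_ (snd_ (snd_ (fst_ #3)))>>) #0
      (Call swaps_f << <<#0; <<fst_ (snd_ (snd_ (fst_ #3)));
          << <<fst_ (fst_ (snd_ (fst_ #3))); #1>>; snd_ (fst_ (snd_ (fst_ #3)))>> >> >>;
        fst_ (snd_ (snd_ (fst_ #3)))>>))
    #0).

Definition reach_step_b := fold_body reach_step_f (fst_ (fst_ #0))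
  (Call reach_from_f << <<#0; <<#1; <<fst_ (snd_ (fst_ #3)); fst_ (snd_ (snd_ (fst_ #3)))>> >> >>;
                        snd_ (snd_ (snd_ (fst_ #3)))>>).

Definition reach_b := fold_body reach_f << <<fst_ (fst_ #0); nil_>>; nil_>>
  (Call reach_step_f << <<#0; snd_ (fst_ #3)>>; #0>>).

Definition finish_b := fold_body finish_f nil_
  (If (Op2 LeR (Op2 Dist (fst_ (fst_ (fst_ #3))) #1) (snd_ (snd_ (fst_ #3))))
    (If (Call addable_f <<#1; fst_ (snd_ (fst_ #3))>>)
      << <<fst_ (fst_ (fst_ #3)); #1>>; snd_ (fst_ (fst_ #3))>> #0)
    #0).

Definition find_trail_b := fold_body find_trail_f nil_
  (Case (Call finish_f << <<#1; <<fst_ (fst_ #3); fst_ (snd_ (fst_ #3))>> >>;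
                          snd_ (snd_ (fst_ #3))>>)
    #0 <<#0; #1>>).

(** Success is wrapped in a cell with tail [nil_], since an empty transversal is itself the empty
    list and would be confused with failure. *)
Definition augment_b := fold_body augment_f <<nil_; nil_>>
  (Case #0 nil_
    (Case (Call find_trail_f << <<#0; fst_ #5>>;
             Call reach_f << <<#3; <<#0; fst_ #5>> >>; #0>> >>)
      nil_ <<Call apply_f <<#2; <<#0; #1>> >>; nil_>>)).

Definition near_b := fold_body near_f false_
  (If (Op2 LeR (Op2 Dist (fst_ (fst_ #3)) #1) (Op2 AddR (snd_ (fst_ #3)) (snd_ (fst_ #3))))
    true_ #0).

Definition far_b := fold_body far_f nil_
  (If (Call near_f << <<#1; fst_ #3>>; #0>>) #0 <<#1; #0>>).

Definition best_for_b := fold_body best_for_f (fst_ (fst_ #0))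
  (Let (Op2 Dist (fst_ (snd_ (fst_ #3))) #1)
    (Case (Call augment_f << <<#0; snd_ (snd_ (snd_ (fst_ #4)))>>;
             Call far_f <<#0; fst_ (snd_ (snd_ (fst_ #4)))>> >>)
      #1
      (Case #3 <<#2; #0>> (If (Op2 LeR #0 #4) #5 <<#4; #2>>)))).

Definition best_b := fold_body best_f nil_
  (Call best_for_f << <<#0; <<#1; fst_ #3>> >>; snd_ (fst_ #3)>>).

Definition app_b := fold_body app_f (fst_ #0) <<#1; #0>>.

Definition all_mis_b := fold_body all_mis_f nil_ (Call app_f <<#0; mis_of #1>>).

Definition points_b := fold_body points_f nil_ <<fst_ #1; #0>>.

Definition max_bot_b := fold_body max_bot_f nil_
  (Case (bot_of #1) #0
    (Case #2 <<#0; nil_>> (If (Op2 LeI #0 #2) <<#2; nil_>> #4))).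

Definition nexts_b :=
  Case (bot_of (snd_ #0)) <<snd_ #0; nil_>>
    (If (Op2 LeI (fst_ #2) #0) (children_of (snd_ #2)) <<snd_ #2; nil_>>).

(* Moves a list onto another one, unless it is longer than the unary budget. *)
Definition take_b :=
  Case (fst_ (snd_ #0)) <<fst_ #0; snd_ (snd_ #0)>>
    (Case (fst_ #2) nil_
      (Call take_f <<#1; <<#3; <<#2; snd_ (snd_ #4)>> >> >>)).

Definition expand_b := fold_body expand_f <<snd_ (fst_ #0); nil_>>
  (Case #0 nil_
    (Call take_f <<#0; <<Call nexts_f <<fst_ (fst_ #5); #3>>; #1>> >>)).

(** The level 0 returned when nothing branches any more is a dummy: such nodes are unchanged by
    every further descent, whatever the level. *)
Definition coarse_b :=
  Case (Call max_bot_f <<nil_; snd_ #0>>) <<Lit (LInt 0); snd_ #0>>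
    (Case (Call expand_f << <<#0; fst_ #2>>; snd_ #2>>) <<#0; snd_ #2>>
      (Call coarse_f <<fst_ #4; #1>>)).

Definition down_b := fold_body down_f nil_
  (Call app_f <<#0; Call nexts_f <<fst_ #3; #1>> >>).

(** One level per doubling of the first component: this descends about log(1/eps) levels without
    division or logarithm in the language. *)
Definition refine_b :=
  If (Op2 LeR (Lit (LReal 1)) (fst_ #0)) (snd_ (snd_ #0))
    (Call refine_f <<Op2 AddR (fst_ #0) (fst_ #0);
       <<Op2 SubI (fst_ (snd_ #0)) (Lit (LInt 1)); Call down_f (snd_ #0)>> >>).

Definition functions_text : seq term :=
  [:: memfst_b; memsnd_b; elems_b; del_b; addable_b; last_addable_b; apply_b;
      swaps_b; reach_from_b; reach_step_b; reach_b; finish_b; find_trail_b;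
      augment_b; near_b; far_b; best_for_b; best_b; app_b; all_mis_b; points_b;
      max_bot_b; nexts_b; take_b; expand_b; coarse_b; down_b; refine_b].

Definition solve_text :=
  Let (Call points_f <<nil_; #0>>)
    (Let (Call all_mis_f <<nil_; #1>>)
      (Case (Call best_f << <<#1; #0>>; #1>>) nil_ (Call elems_f <<nil_; #1>>))).

(** The two tests remove the cases in which the analysis fails: a single point, which gives neither
    a scale of distances nor [1 <= D], and rank 0, where the budget would not even hold the root.
    Otherwise the independent set of the root is the unary budget of [coarse_f]. *)
Definition main_text :=
  If (Op2 LeI (weight_of #0) (Lit (LInt 1))) (mis_of #0)
    (Case (mis_of #0) nil_
      (Let (Call refine_f <<#3; Call coarse_f <<mis_of #2; <<#2; nil_>> >> >>)
        solve_text)).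

Definition center_program := Program functions_text main_text.

End Program.

(** * Time bounds for evaluation *)

Section Bounds.
Local Open Scope nat_scope.
Variables (R : realType) (X : finType) (d : X -> X -> R) (M : matroid X).
Local Notation value := (value R X).
Variable F : seq term.

(** Upper bounds replace exact times so that they depend on the program text only: a test is charged
    for both of its branches. *)
Definition evb env e (v : value) B :=
  exists2 t, Defs.eval d M F env e v t & t <= B.

Definition fnb f (v w : value) B :=
  exists2 body, onth F f = Some body & evb [:: v] body w B.

Lemma evb_le env e v B B' : evb env e v B -> B <= B' -> evb env e v B'.
Proof. by case=> t ? le ?; exists t => //; apply: leq_trans le _. Qed.

Lemma fnb_le f v w B B' : fnb f v w B -> B <= B' -> fnb f v w B'.
Proof. by case=> body Ef ev le; exists body => //; apply: evb_le ev le. Qed.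

Lemma evb_eq env e v w B : evb env e v B -> v = w -> evb env e w B.
Proof. by move=> ? <-. Qed.

Lemma evb_var env i v : onth env i = Some v -> evb env (Var i) v 1.
Proof. by move=> ?; exists 1 => //; constructor. Qed.

Lemma fnb_intro f body v w B B' :
  onth F f = Some body -> evb [:: v] body w B -> B <= B' -> fnb f v w B'.
Proof. by move=> Ef ev le; exists body => //; apply: evb_le ev le. Qed.

Lemma evb_lit env c : evb env (Lit c) (lit_value R X c) 1.
Proof. by exists 1 => //; constructor. Qed.

Lemma evb_op1 env o e v w B :
  evb env e v B -> op1_value M o v = Some w -> evb env (Op1 o e) w B.+1.
Proof. by case=> t ev le E; exists t.+1 => //; econstructor; eassumption. Qed.

Lemma dec_enc_points s : dec_points (enc_points s : value) = Some s.
Proof. by elim: s => //= p s; rewrite /enc_points => ->. Qed.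

Lemma evb_indep env e v s B :
  evb env e v B -> v = enc_points s -> evb env (Op1 Indep e) (VBool (ind M s)) B.+1.
Proof.
move=> ev E; apply: evb_op1 ev _.
by rewrite E /op1_value dec_enc_points.
Qed.

Lemma evb_op2 env o e1 e2 v1 v2 w B1 B2 :
  evb env e1 v1 B1 -> evb env e2 v2 B2 -> op2_value d o v1 v2 = Some w ->
  evb env (Op2 o e1 e2) w (B1 + B2).+1.
Proof.
case=> t1 ev1 le1 [t2 ev2 le2] E; exists (t1 + t2).+1; last by lia.
by econstructor; eassumption.
Qed.

Lemma evb_if env e b e1 e2 w B B1 B2 :
  evb env e (VBool b) B -> (b -> evb env e1 w B1) -> (~~ b -> evb env e2 w B2) ->
  evb env (If e e1 e2) w (B + B1 + B2).+1.
Proof.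
case=> t ev le H1 H2.
have [t' ev' le'] : evb env (if b then e1 else e2) w (B1 + B2).
  by case: b H1 H2 {ev} => [/(_ isT) H _|_ /(_ isT) H]; apply: evb_le H _; lia.
by exists (t + t').+1; [econstructor; eassumption | lia].
Qed.

Lemma evb_let env e1 e2 v w B1 B2 :
  evb env e1 v B1 -> evb (v :: env) e2 w B2 -> evb env (Let e1 e2) w (B1 + B2).+1.
Proof.
by case=> t ? ? [t' ? ?]; exists (t + t').+1; [econstructor; eassumption | lia].
Qed.

Lemma evb_call env f e v w B1 B2 :
  evb env e v B1 -> fnb f v w B2 -> evb env (Call f e) w (B1 + B2).+1.
Proof.
case=> t ? ? [body ? [t' ? ?]]; exists (t + t').+1; last by lia.
by econstructor; eassumption.
Qed.

Lemma enc_points_cons x s :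
  VPair (VPoint x) (enc_points s) = enc_points (x :: s) :> value.
Proof. by []. Qed.

(** A nonempty result is a cell with two components, so that the same case rule serves for a value
    wrapped with [VNil] and for genuine pairs such as a radius with its transversal or a budget with
    its nodes. *)
Definition enc_option A (f g : A -> value) (o : option A) : value :=
  if o is Some a then VPair (f a) (g a) else VNil.

Lemma evb_case_option env e e1 e2 w A (f g : A -> value) o B B1 B2 :
  evb env e (enc_option f g o) B -> (o = None -> evb env e1 w B1) ->
  (forall a, o = Some a -> evb [:: f a, g a & env] e2 w B2) ->
  evb env (Case e e1 e2) w (B + B1 + B2).+1.
Proof.
case: o => [a|] [t ev le] H1 H2.
  case: (H2 _ erefl) => t' ev' le'.
  by exists (t + t').+1; [apply: EvCasePair ev ev' | lia].
case: (H1 erefl) => t' ev' le'.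
by exists (t + t').+1; [apply: EvCaseNil ev ev' | lia].
Qed.

Lemma evb_case_list env e e1 e2 w A (f : A -> value) s B B1 B2 :
  evb env e (enc_seq [seq f a | a <- s]) B -> (s = [::] -> evb env e1 w B1) ->
  (forall a s', s = a :: s' -> evb [:: f a, enc_seq [seq f a | a <- s'] & env] e2 w B2) ->
  evb env (Case e e1 e2) w (B + B1 + B2).+1.
Proof.
case: s => [|a s] [t ev le] H1 H2; last first.
  case: (H2 _ _ erefl) => t' ev' le'.
  by exists (t + t').+1; [apply: EvCasePair ev ev' | lia].
case: (H1 erefl) => t' ev' le'.
by exists (t + t').+1; [apply: EvCaseNil ev ev' | lia].
Qed.

(* The potential [Phi] amortizes the cost of steps. *)
Lemma fold_potential f base step par A B (encA : A -> value) (encB : B -> value)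
    (phi : seq A -> B) (Phi : B -> nat) c0 c l :
  onth F f = Some (fold_body f base step) ->
  evb [:: VPair par VNil] base (encB (phi [::])) c0 ->
  (forall l1 a l', l = l1 ++ a :: l' -> exists2 c',
     evb [:: encB (phi l'); encA a; enc_seq [seq encA a | a <- l'];
             VPair par (enc_seq [seq encA a | a <- a :: l'])] step
       (encB (phi (a :: l'))) c' &
     c' + Phi (phi (a :: l')) <= c + Phi (phi l')) ->
  exists2 c', fnb f (VPair par (enc_seq [seq encA a | a <- l])) (encB (phi l)) c' &
    c' + Phi (phi l) <= c0 + Phi (phi [::]) + 3 + size l * (c + 9).
Proof.
move=> Ef H0; elim: l => [|a l IH] H.
  exists (2 + c0 + 0).+1; last by lia.
  exists (fold_body f base step) => //.
  have [t ev le] := H0; exists (2 + t).+1; last by lia.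
  by apply: EvCaseNil ev; apply: (EvOp1 (v := VPair par VNil) (t := 1)) => //; apply: EvVar.
have [|c1 [body Eb [t1 ev1 le1]] p1] := IH.
  by move=> l1 b l' E; apply: (H (a :: l1)); rewrite E.
have [c2 [t2 ev2 le2] p2] := H [::] a l erefl.
exists (9 + c1 + c2); last by rewrite /= mulSn; lia.
exists (fold_body f base step) => //.
exists (2 + (4 + t1).+1 + t2).+2; last by lia.
rewrite (_ : _.+2 = (2 + ((4 + t1).+1 + t2).+1).+1); last by lia.
set arg := VPair par (enc_seq [seq encA a | a <- a :: l]) in ev2 *.
apply: EvCasePair; first by apply: (EvOp1 (v := arg) (t := 1)) => //; apply: EvVar.
apply: EvLet ev2; apply: EvCall Eb ev1.
apply: (EvOp2 (v1 := par) (t1 := 2) (t2 := 1)) => //; last exact: EvVar.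
by apply: (EvOp1 (v := arg) (t := 1)) => //; apply: EvVar.
Qed.

(** The 9 steps are the list test and the recursive call of [fold_body]; 100 covers a base case of
    cost 90 and its test. *)
Definition fold_cost n c := 100 + n * (c + 9).

Lemma fold_bound f base step par A B (encA : A -> value) (encB : B -> value)
    (phi : seq A -> B) l n c :
  onth F f = Some (fold_body f base step) -> size l <= n ->
  evb [:: VPair par VNil] base (encB (phi [::])) 90 ->
  (forall l1 a l', l = l1 ++ a :: l' ->
     evb [:: encB (phi l'); encA a; enc_seq [seq encA a | a <- l'];
             VPair par (enc_seq [seq encA a | a <- a :: l'])] step
       (encB (phi (a :: l'))) c) ->
  fnb f (VPair par (enc_seq [seq encA a | a <- l])) (encB (phi l)) (fold_cost n c).
Proof.
move=> Ef le H0 H.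
have [|c' [body Eb ev] lec] := fold_potential (encA := encA) (encB := encB) (phi := phi) (Phi := fun=> 0) Ef H0 (c := c) (l := l).
  by move=> l1 a l' E; exists c; [exact: H E | lia].
exists body => //; apply: evb_le ev _; rewrite /fold_cost.
have : size l * (c + 9) <= n * (c + 9) by rewrite leq_mul2r le orbT.
lia.
Qed.

End Bounds.

Ltac fn := fail.

(** Bounds are existential variables filled in by following the syntax, so a cost proof ends with a
    comparison of explicit sums. The tactic [fn] is the hook for the functions already analysed. *)
Ltac ev := lazymatch goal with
  | |- evb _ _ _ _ (Var _) _ _ => eapply evb_var; reflexivity
  | |- evb _ _ _ _ (Lit _) _ _ => eapply evb_lit
  | |- evb _ _ _ _ (Op1 Indep _) _ _ => eapply evb_indep; [ev | exact: enc_points_cons]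
  | |- evb _ _ _ _ (Op1 _ _) _ _ => eapply evb_op1; [ev | reflexivity]
  | |- evb _ _ _ _ (Op2 _ _ _) _ _ => eapply evb_op2; [ev | ev | reflexivity]
  | |- evb _ _ _ _ (Call _ _) _ _ => eapply evb_call; [ev | fn]
  | |- evb _ _ _ _ (Let _ _) _ _ => eapply evb_let; [ev | ev]
  end.

Ltac evr := lazymatch goal with
  | |- evb _ _ _ _ (If _ _ _) _ _ => eapply evb_if; [ev | intro; evr | intro; evr]
  | |- evb _ _ _ _ (Let _ _) _ _ => eapply evb_let; [ev | evr]
  | |- evb _ _ _ _ (Case _ _ _) _ _ => idtac
  | |- _ => eapply evb_eq; [ev |]
  end.

Ltac bound := by clear; lia.

(** * Cost of the search for a transversal *)

Section SolverCost.
Local Open Scope nat_scope.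
Variables (R : realType) (X : finType) (d : X -> X -> R) (M : matroid X).
Local Notation value := (value R X).
Local Notation fnb := (fnb d M functions_text).
Local Notation evb := (evb d M functions_text).
Variable n : nat.

Definition enc_pair (e : X * X) : value := VPair (VPoint e.1) (VPoint e.2).

Definition enc_pairs (I : seq (X * X)) : value := enc_seq [seq enc_pair e | e <- I].

Definition enc_reached (nd : X * seq (X * X)) : value :=
  VPair (VPoint nd.1) (enc_pairs nd.2).

Definition enc_reach (rs : seq (X * seq (X * X))) : value :=
  enc_seq [seq enc_reached nd | nd <- rs].

Lemma memfst_fnb p rs : size rs <= n ->
  fnb memfst_f (VPair (VPoint p) (enc_reach rs)) (VBool (p \in [seq nd.1 | nd <- rs]))
    (fold_cost n 60).
Proof.
move=> le; apply: (fold_bound (encA := enc_reached) (encB := VBool)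
  (phi := fun rs => p \in [seq nd.1 | nd <- rs])) => //.
  by eapply evb_le; [evr; done | bound].
move=> l1 a l' _; eapply evb_le; [evr | bound].
- by rewrite /= inE eq_sym H.
- by rewrite /= inE eq_sym (negbTE H).
Qed.

Lemma memsnd_fnb x I : size I <= n ->
  fnb memsnd_f (VPair (VPoint x) (enc_pairs I)) (VBool (x \in elems I)) (fold_cost n 60).
Proof.
move=> le; apply: (fold_bound (encA := enc_pair) (encB := VBool)
  (phi := fun I => x \in elems I)) => //.
  by eapply evb_le; [evr; done | bound].
move=> l1 a l' _; eapply evb_le; [evr | bound].
- by rewrite /= inE eq_sym H.
- by rewrite /= inE eq_sym (negbTE H).
Qed.

Lemma elems_fnb v I : size I <= n ->
  fnb elems_f (VPair v (enc_pairs I)) (enc_points (elems I)) (fold_cost n 60).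
Proof.
move=> le; apply: (fold_bound (encA := enc_pair) (encB := enc_points)
  (phi := fun I => elems I)) => //.
  by eapply evb_le; [evr; done | bound].
by move=> l1 a l' _; eapply evb_le; [evr | bound].
Qed.

Lemma del_fnb p I : size I <= n ->
  fnb del_f (VPair (VPoint p) (enc_pairs I)) (enc_pairs (del p I)) (fold_cost n 60).
Proof.
move=> le; apply: (fold_bound (encA := enc_pair) (encB := enc_pairs)
  (phi := fun I => del p I)) => //.
  by eapply evb_le; [evr; done | bound].
move=> l1 a l' _; eapply evb_le; [evr | bound].
- by rewrite /= H.
- by rewrite /= H.
Qed.

Ltac fn ::= first
  [ eapply memfst_fnb | eapply memsnd_fnb | eapply elems_fnb | eapply del_fnb ].

Definition addable_c n := 40 + (fold_cost n 60 + fold_cost n 60).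

Lemma addable_fnb x I : size I <= n ->
  fnb addable_f (VPair (VPoint x) (enc_pairs I)) (VBool (addable M I x)) (addable_c n).
Proof.
move=> le; eapply fnb_intro; [reflexivity | unfold addable_b; evr | rewrite /addable_c; bound] => //.
- by rewrite /addable H.
- by rewrite /addable H.
Qed.

Definition last_addable_c n := fold_cost n (60 + addable_c n).

Lemma last_addable_fnb I tr : size I <= n -> size tr <= n ->
  fnb last_addable_f (VPair (enc_pairs I) (enc_pairs tr)) (enc_pairs (last_addable M I tr))
    (last_addable_c n).
Proof.
move=> leI le; apply: (fold_bound (encA := enc_pair) (encB := enc_pairs)
  (phi := fun tr => last_addable M I tr)) => //.
  by eapply evb_le; [evr; done | bound].
move=> l1 a l' _; eapply evb_le.
  eapply (evb_case_list (f := enc_pair) (s := last_addable M I l')); first by ev.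
    move=> /= ->.
    eapply evb_if; [eapply evb_call; [ev | exact: addable_fnb] | |].
      by move=> /= ->; evr.
    by move=> /negbTE /= ->; evr.
  by move=> e s' /= ->; evr.
bound.
Qed.

Lemma size_del_le p (I : seq (X * X)) : size (del p I) <= size I.
Proof. by rewrite /del size_filter count_size. Qed.

Definition apply_c n m := 100 + last_addable_c n + m * (100 + last_addable_c n + fold_cost n 60).

(** The sum of the two sizes is the invariant: a step adds at most one pair to [I] and removes at
    least one from the trail. *)
Lemma apply_fnb m I tr : size tr <= m -> size I + size tr <= n ->
  fnb apply_f (VPair (enc_pairs I) (enc_pairs tr)) (enc_pairs (apply_trail M m I tr))
    (apply_c n m).
Proof.
elim: m I tr => [|m IH] I tr le len.
  have -> : tr = [::] by case: tr le {len}.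
  eapply fnb_intro; [reflexivity| unfold apply_b |].
    eapply (evb_case_list (f := enc_pair) (s := last_addable M I [::]) (B2 := 0)) => //.
      by eapply evb_call; [ev | apply: last_addable_fnb => //; lia].
    by move=> _; evr.
  by rewrite /apply_c; bound.
eapply fnb_intro; [reflexivity| unfold apply_b |].
  eapply (evb_case_list (f := enc_pair) (s := last_addable M I tr)).
  - by eapply evb_call; [ev | apply: last_addable_fnb => //; lia].
  - by move=> /= ->; evr.
  move=> e rest E; have := last_addable_cat M I tr; rewrite /= E => -[[l El] _ _].
  have := congr1 size El; rewrite size_cat /= => sE.
  eapply evb_call; [ev | ].
    by lia.
  apply: (IH (e :: del e.1 I)); first by lia.
  have sd := size_del_le e.1 I.
  apply: leq_trans len; rewrite sE /= addSn -addnS.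
  exact: leq_add sd (leq_addl _ _).
by rewrite /apply_c mulSn; bound.
Qed.

Section Search.
Variables (r : R) (I : seq (X * X)) (p0 : X).
Hypothesis sI : size I < n.

Definition ball_rel (r : R) : rel X := fun p x => (d p x <= r)%R.

(** The list of reached pivots has length at most [n] only because it is valid, so the cost of the
    search is bounded together with its invariant. *)
Definition reached p tr rs :=
  [/\ p \in [seq nd.1 | nd <- rs], valid_trail M (ball_rel r) I p0 p tr,
      {subset [seq e.1 | e <- tr] <= [seq nd.1 | nd <- rs]} &
      valid_reach M (ball_rel r) I p0 rs].

Lemma reached_extends p tr rs rs' : reached p tr rs -> extends rs rs' ->
  valid_reach M (ball_rel r) I p0 rs' -> reached p tr rs'.
Proof.
case=> pr vt sub _ ex v; have ext : {subset [seq nd.1 | nd <- rs] <= [seq nd.1 | nd <- rs']}.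
  by move=> y /mapP[nd ndr ->]; apply: map_f; exact: (extends_sub ex).
by split=> //; [exact: ext | move=> y /sub/ext].
Qed.

Lemma valid_reach_le rs : valid_reach M (ball_rel r) I p0 rs -> size rs <= n.
Proof. by move=> /valid_reach_size le; exact: leq_trans le sI. Qed.

Definition swaps_c n := fold_cost n (80 + fold_cost n 60 + fold_cost n 60 + fold_cost n 60).

Lemma swaps_fnb p x tr rs :
  reached p tr rs -> ball_rel r p x -> x \notin elems I ->
  fnb swaps_f (VPair (VPair (enc_reach rs)
                 (VPair (enc_pairs I) (enc_pairs ((p, x) :: tr)))) (enc_pairs I))
    (enc_reach (swaps M I p x tr rs I)) (swaps_c n).
Proof.
move=> [pr vt sub vr] bpx xI; apply: (fold_bound (encA := enc_pair) (encB := enc_reach)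
  (phi := fun l => swaps M I p x tr rs l)) => //; first exact: ltnW.
  by eapply evb_le; [evr; done | bound].
move=> l1 a l' El; eapply evb_le; [evr | bound].
- by apply: valid_reach_le; apply: swaps_valid => // y yl; rewrite El mem_cat inE yl !orbT.
- by rewrite /= H.
- exact: ltnW.
- exact: leq_trans (size_del_le _ _) (ltnW sI).
- by rewrite /= (negbTE H) H0.
- by rewrite /= (negbTE H) (negbTE H0).
Qed.

Definition reach_from_c n := fold_cost n (80 + fold_cost n 60 + swaps_c n).

Lemma reach_from_fnb p tr rs Q : reached p tr rs -> size Q <= n ->
  fnb reach_from_f (VPair (VPair (enc_reach rs) (VPair (VPair (VPoint p) (enc_pairs tr))
       (VPair (enc_pairs I) (VReal r)))) (enc_points Q))
    (enc_reach (reach_from M (ball_rel r) I p tr rs Q)) (reach_from_c n).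
Proof.
move=> rd sQ; apply: (fold_bound (encA := VPoint) (encB := enc_reach)
  (phi := fun l => reach_from M (ball_rel r) I p tr rs l)) => //.
  by eapply evb_le; [evr; done | bound].
move=> l1 a l' El; eapply evb_le.
  eapply evb_if; first by ev.
    move=> C; eapply evb_if; first by ev; exact: ltnW.
      by move=> C'; evr; rewrite /= C' andbF.
    move=> C'; eapply evb_eq; first eapply evb_call.
    - by ev.
    - apply: (@swaps_fnb p a tr (reach_from M (ball_rel r) I p tr rs l')) => //.
      case: (rd) => *; apply: reached_extends rd (reach_from_extends _ _ _ _ _ _ _) _.
      exact: reach_from_valid.
    by rewrite /= /ball_rel C C'.
  by move=> C; evr; rewrite /= /ball_rel (negbTE C).
bound.
Qed.

Definition reach_step_c n := fold_cost n (80 + reach_from_c n).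

Lemma reach_step_fnb rs Q : valid_reach M (ball_rel r) I p0 rs -> size Q <= n ->
  fnb reach_step_f (VPair (VPair (enc_reach rs) (VPair (enc_pairs I)
       (VPair (VReal r) (enc_points Q)))) (enc_reach rs))
    (enc_reach (reach_step M (ball_rel r) I Q rs rs)) (reach_step_c n).
Proof.
move=> vr sQ; apply: (fold_bound (encA := enc_reached) (encB := enc_reach)
  (phi := fun l => reach_step M (ball_rel r) I Q rs l)) => //; first exact: valid_reach_le.
  by eapply evb_le; [evr; done | bound].
move=> l1 a l' El; eapply evb_le.
  eapply evb_call; first by ev.
  apply: reach_from_fnb => //.
  have sub : {subset a :: l' <= rs} by move=> y yl; rewrite El mem_cat yl orbT.
  have ar : a \in rs by apply: sub; rewrite inE eqxx.
  have [_ _ /(_ _ ar) [vt st]] := vr.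
  apply: (@reached_extends _ _ rs); [|exact: reach_step_extends|].
    by split=> //; exact: map_f.
  by apply: reach_step_valid => // y yl; apply: sub; rewrite inE yl orbT.
bound.
Qed.

Definition reach_c n := fold_cost n (80 + reach_step_c n).

Lemma reach_fnb Q : size Q <= n ->
  fnb reach_f (VPair (VPair (VPoint p0) (VPair (enc_pairs I)
       (VPair (VReal r) (enc_points Q)))) (enc_pairs I))
    (enc_reach (reach M (ball_rel r) I Q p0 I)) (reach_c n).
Proof.
move=> sQ; apply: (fold_bound (encA := enc_pair) (encB := enc_reach)
  (phi := fun l => reach M (ball_rel r) I Q p0 l)) => //; first exact: ltnW.
  by eapply evb_le; [evr; done | bound].
move=> l1 a l' El; eapply evb_le.
  eapply evb_call; first by ev.
  by apply: reach_step_fnb => //; exact: reach_valid.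
bound.
Qed.

Definition finish_c n := fold_cost n (80 + addable_c n).

Lemma finish_fnb p tr Q : size Q <= n ->
  fnb finish_f (VPair (VPair (VPair (VPoint p) (enc_pairs tr)) (VPair (enc_pairs I) (VReal r)))
       (enc_points Q))
    (enc_pairs (finish M (ball_rel r) I p tr Q)) (finish_c n).
Proof.
move=> sQ; apply: (fold_bound (encA := VPoint) (encB := enc_pairs)
  (phi := fun l => finish M (ball_rel r) I p tr l)) => //.
  by eapply evb_le; [evr; done | bound].
move=> l1 a l' El; eapply evb_le.
  eapply evb_if; first by ev.
    move=> C; eapply evb_if; first by eapply evb_call; [ev | exact: addable_fnb (ltnW sI)].
      by move=> C'; evr; rewrite /= /ball_rel C C'.
    by move=> C'; evr; rewrite /= (negbTE C') andbF.
  by move=> C; evr; rewrite /= /ball_rel (negbTE C).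
bound.
Qed.

Definition find_trail_c n := fold_cost n (80 + finish_c n).

Lemma find_trail_fnb rs Q : size rs <= n -> size Q <= n ->
  fnb find_trail_f (VPair (VPair (enc_pairs I) (VPair (VReal r) (enc_points Q)))
       (enc_reach rs))
    (enc_pairs (find_trail M (ball_rel r) I Q rs)) (find_trail_c n).
Proof.
move=> srs sQ; apply: (fold_bound (encA := enc_reached) (encB := enc_pairs)
  (phi := fun l => find_trail M (ball_rel r) I Q l)) => //.
  by eapply evb_le; [evr; done | bound].
move=> l1 a l' El; eapply evb_le.
  eapply (evb_case_list (f := enc_pair) (s := finish M (ball_rel r) I a.1 a.2 Q)).
  - by eapply evb_call; [ev | exact: finish_fnb].
  - by move=> /= ->; evr.
  by move=> e w /= ->; evr.
bound.
Qed.

End Search.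

Definition enc_result (o : option (seq (X * X))) : value :=
  enc_option enc_pairs (fun=> VNil) o.

Definition augment_c n :=
  fold_cost n (100 + find_trail_c n + reach_c n + apply_c n n).

(** Uniqueness and disjointness enter through [augment_sound], which bounds a partial transversal by
    the number of pivots processed. Twice the number of pivots, plus 2, leaves room for a
    transversal and a trail together in [apply_fnb]. *)
Lemma augment_fnb r Q piv :
  uniq piv ->
  (forall p q x, p \in piv -> q \in piv -> ball_rel r p x -> ball_rel r q x -> p = q) ->
  size Q <= n -> size piv + size piv + 2 <= n ->
  fnb augment_f (VPair (VPair (VReal r) (enc_points Q)) (enc_points piv))
    (enc_result (augment M (ball_rel r) Q piv)) (augment_c n).
Proof.
move=> upiv disj sQ spiv; apply: (fold_bound (encA := VPoint) (encB := enc_result)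
  (phi := fun l => augment M (ball_rel r) Q l)) => //.
  by apply: leq_trans spiv; rewrite -addnA; exact: leq_addr.
  by eapply evb_le; [evr; done | bound].
move=> l1 p l' El; eapply evb_le.
  eapply (evb_case_option (f := enc_pairs) (g := fun=> VNil)); first by ev.
    by move=> E; evr; rewrite /= E.
  move=> I EI.
  have sub : {subset p :: l' <= piv} by move=> y yl; rewrite El mem_cat yl orbT.
  have : uniq (p :: l') by move: upiv; rewrite El cat_uniq => /and3P[].
  rewrite [uniq _]/= => /andP[pl' ul'].
  have sub' : {subset l' <= piv} by move=> y yl; apply: sub; rewrite inE yl orbT.
  have tI := augment_sound disj ul' sub' EI.
  have sI : size I = size l' := transversal_size ul' tI.
  have sl : size l' < size piv by rewrite El size_cat /=; lia.
  have ltp : (size I).*2.+2 <= n.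
    apply: leq_trans spiv; rewrite addnn addn2 !ltnS leq_double sI; exact: ltnW.
  have ltI : size I < n.
    by apply: leq_trans ltp; rewrite ltnS -addnn; apply: leq_trans (leqnSn _); exact: leq_addr.
  have vr := reach_valid M (ball_rel r) I Q p I.
  set rs := reach M (ball_rel r) I Q p I in vr.
  eapply (evb_case_list (f := enc_pair) (s := find_trail M (ball_rel r) I Q rs)).
  - eapply evb_call; first eapply evb_op2; [by ev | eapply evb_call; [by ev|]|reflexivity|].
      exact: reach_fnb.
    by apply: find_trail_fnb => //; exact: (valid_reach_le ltI vr).
  - by move=> Ef; evr; rewrite /= EI /= -/rs Ef.
  move=> e w Ef; have [//|nd [x [ndr Ew xQ bx ax]]] := find_trailP Ef.
  (* A trail visits distinct pivots, all of them [p] or already represented in [I]. *)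
  have sw : size (e :: w) <= (size I).+1.
    have [_ sr vrn] := vr; have [vt st] := vrn _ ndr.
    rewrite Ew -(size_map fst) -[X in _ <= X.+1](size_map fst I).
    have := valid_trail_uniq vt; rewrite -/(map fst ((nd.1, x) :: nd.2)) => uw.
    apply: (@uniq_leq_size _ _ (p :: _) uw) => y; rewrite inE => /orP[/eqP ->|/st/sr //].
    by apply: sr; exact: map_f.
  eapply evb_eq; first eapply evb_op2; [eapply evb_call; first by ev|by ev|reflexivity|].
    apply: (fnb_le (B' := apply_c n n)); first apply: (@apply_fnb (size (e :: w)) I (e :: w)) => //.
      apply: leq_trans ltp; apply: (@leq_trans (size I + (size I).+1)).
        by rewrite leq_add2l.
      by rewrite addnS addnn.
    by rewrite /apply_c leq_add2l leq_mul2r (leq_trans sw ltI) orbT.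
  by rewrite /= EI /= -/rs Ef.
bound.
Qed.

End SolverCost.

(** * Choice of the radius *)

Section Selection.
Variables (R : realType) (X : finType) (d : X -> X -> R) (M : matroid X).
Hypothesis d_refl : forall p, d p p = 0.
Hypothesis d_ge0 : forall p q, 0 <= d p q.
Hypothesis d_sym : forall p q, d p q = d q p.
Hypothesis d_tri : forall q p s, d p s <= d p q + d q s.

Definition far (r : R) (pts : seq X) : seq X :=
  foldr (fun p acc => if has (fun q => d p q <= r + r) acc then acc else p :: acc)
    [::] pts.

Definition better (r : R) (new : option (seq (X * X))) (old : option (R * seq (X * X))) :=
  if new is Some J then
    if old is Some rJ then if rJ.1 <= r then old else Some (r, J) else Some (r, J)
  else old.

Definition attempt pts Q r := augment M (ball_rel d r) Q (far r pts).

Definition best_for pts Q p acc (l : seq X) :=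
  foldr (fun q acc => better (d p q) (attempt pts Q (d p q)) acc) acc l.

Definition best pts Q (l : seq X) :=
  foldr (fun p acc => best_for pts Q p acc Q) None l.

Lemma far_sub r pts : {subset far r pts <= pts}.
Proof.
elim: pts => [//|p pts IH] y /=; case: ifP => _; rewrite !inE.
  by move=> /IH ->; rewrite orbT.
by case/orP => [->//|/IH ->]; rewrite orbT.
Qed.

Lemma far_size r pts : (size (far r pts) <= size pts)%N.
Proof. by elim: pts => [//|p pts IH] /=; case: ifP => // _; apply: leq_trans IH _. Qed.

Lemma far_uniq r pts : 0 <= r -> uniq (far r pts).
Proof.
move=> r0; elim: pts => [//|p pts IH] /=; case: ifPn => //= np; rewrite IH andbT.
by apply: contra np => pin; apply/hasP; exists p => //; rewrite d_refl addr_ge0.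
Qed.

Lemma far_disjoint r pts p q x : p \in far r pts -> q \in far r pts ->
  ball_rel d r p x -> ball_rel d r q x -> p = q.
Proof.
move=> + + px qx.
have pq : d p q <= r + r by rewrite (le_trans (d_tri x _ _)) // lerD // d_sym.
elim: pts => [//|s pts IH] /=; case: ifPn => // /hasPn ns.
rewrite !inE => /orP[/eqP ps|pf] /orP[/eqP qs|qf]; last exact: IH.
- by rewrite ps qs.
- by have := ns _ qf; rewrite -ps pq.
- by have := ns _ pf; rewrite -qs d_sym pq.
Qed.

Lemma far_cover r pts p : 0 <= r -> p \in pts -> exists2 q, q \in far r pts & d p q <= r + r.
Proof.
move=> r0; elim: pts => [//|s pts IH] /=; rewrite inE => /orP[/eqP ->|/IH[q qf pq]].
  case: ifPn => [/hasP[q qf sq]|_]; first by exists q.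
  by exists s; rewrite ?inE ?eqxx // d_refl addr_ge0.
by case: ifP => _; exists q => //; rewrite inE qf orbT.
Qed.

Definition accepted pts Q (o : option (R * seq (X * X))) :=
  forall r J, o = Some (r, J) -> 0 <= r /\ attempt pts Q r = Some J.

Definition below (o : option (R * seq (X * X))) r :=
  if o is Some rJ then rJ.1 <= r else false.

Lemma better_accepted pts Q r o :
  0 <= r -> accepted pts Q o -> accepted pts Q (better r (attempt pts Q r) o).
Proof.
move=> r0 ao; rewrite /better; case E : attempt => [J|//].
by case: o ao => [rJ|] ao; [case: ifP => // _|]; move=> _ _ [<- <-].
Qed.

Lemma better_below r new o r' : below o r' -> below (better r new o) r'.
Proof.
rewrite /better; case: new => // J; case: o => // -[r0 J0] /=.
by case: (lerP r0 r) => //= lt le; exact: (le_trans (ltW lt) le).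
Qed.

Lemma better_new r J o : below (better r (Some J) o) r.
Proof. by case: o => [[r0 J0]|] /=; [case: ifP => //=|]. Qed.

Lemma best_for_accepted pts Q p acc l :
  accepted pts Q acc -> accepted pts Q (best_for pts Q p acc l).
Proof. by move=> a; elim: l => //= q l; exact: better_accepted. Qed.

Lemma best_accepted pts Q l : accepted pts Q (best pts Q l).
Proof. by elim: l => //= p l; exact: best_for_accepted. Qed.

Lemma best_for_below pts Q p acc l r : below acc r -> below (best_for pts Q p acc l) r.
Proof. by move=> b; elim: l => //= q l; exact: better_below. Qed.

Lemma best_for_le pts Q p acc l q : q \in l -> attempt pts Q (d p q) <> None ->
  below (best_for pts Q p acc l) (d p q).
Proof.
move=> + ne; elim: l => [//|q' l IH]; rewrite inE => /orP[/eqP <- /=|/IH b].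
  by case: attempt ne => // J _; exact: better_new.
exact: better_below.
Qed.

Lemma best_le pts Q l p q : p \in l -> q \in Q -> attempt pts Q (d p q) <> None ->
  below (best pts Q l) (d p q).
Proof.
move=> + qQ ne; elim: l => [//|p' l IH]; rewrite inE => /orP[/eqP <- /=|/IH b].
  exact: best_for_le.
exact: best_for_below.
Qed.

(* The least successful radius r is at most the radius rho of any feasible C:
   the nearest points of C to the pivots form an independent transversal. *)
Lemma best_approx (pts Q : seq X) (C : {set X}) (rho : R) p0 :
  p0 \in pts -> C \in indep M -> {subset C <= Q} ->
  (forall p, p \in pts -> exists2 c, c \in C & d p c <= rho) ->
  exists r J, [/\ best pts Q pts = Some (r, J), uniq (elems J), ind M (elems J),
    (size J <= size pts)%N &
    forall p, p \in pts -> exists2 x, x \in elems J & d p x <= rho + rho + rho].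
Proof.
move=> p0pts Ci CQ cov.
have [c0 c0C _] := cov _ p0pts.
have /choice[g gP] : forall p, exists c, c \in C /\ (forall c', c' \in C -> d p c <= d p c').
  by move=> p; case: (@arg_minP _ _ _ c0 (mem C) (d p) c0C) => c cC cmin; exists c.
have [p1 p1pts p1max] :
    exists2 p, p \in pts & forall q, q \in pts -> d q (g q) <= d p (g p).
  by case: (@arg_maxP _ _ _ p0 (mem pts) (fun p => d p (g p)) p0pts) => p; exists p.
(* The largest distance from a node point to its nearest point of [C] is one of the tested radii,
   because [C] lies in [Q]. At exactly this radius the nearest points form a transversal, so
   monotonicity of success in the radius never comes up. *)
set r1 := d p1 (g p1) in p1max.
have r1rho : r1 <= rho.
  by have [c cC le] := cov _ p1pts; apply: le_trans le; case: (gP p1) => _; apply.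
have ne : attempt pts Q r1 <> None.
  apply: (@augment_complete X M (ball_rel d r1) (far r1 pts) _ Q g).
  - by move=> p q x; exact: far_disjoint.
  - exact: far_uniq (d_ge0 _ _).
  - by move=> p /far_sub ppts; split; [apply: CQ; case: (gP p) | exact: p1max].
  apply: (@indep_subset _ M _ C) => //; apply/subsetP => x; rewrite inE => /mapP[p _ ->].
  by case: (gP p).
have := best_le p1pts (CQ _ (proj1 (gP p1))) ne.
case E : best => [[r J]|//] /= rr1.
have [r0 aJ] := best_accepted E.
have disj p q x : p \in far r pts -> q \in far r pts -> ball_rel d r p x ->
  ball_rel d r q x -> p = q by exact: far_disjoint.
have tJ : transversal M (ball_rel d r) (far r pts) J.
  by apply: (augment_sound disj) aJ; [exact: far_uniq|].
exists r, J; split=> //.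
- by apply: (transversal_elems_uniq disj) tJ.
- by case: tJ.
- by rewrite (transversal_size _ tJ) ?far_size // far_uniq.
move=> p /(far_cover r0)[q qf pq].
case: tJ => _ EJ bJ _; move: qf; rewrite -EJ => /mapP[e eJ Eq].
exists e.2; first exact: map_f.
apply: le_trans (d_tri q _ _) _; apply: lerD.
  by apply: le_trans pq _; rewrite lerD // (le_trans rr1).
by rewrite Eq; apply: le_trans (bJ _ eJ) (le_trans rr1 r1rho).
Qed.

Section Cost.
Local Open Scope nat_scope.
Local Notation value := (value R X).
Local Notation fnb := (fnb d M functions_text).
Variable n : nat.

Lemma near_fnb p r l : size l <= n ->
  fnb near_f (VPair (VPair (VPoint p) (VReal r)) (enc_points l))
    (VBool (has (fun q => d p q <= r + r)%R l)) (fold_cost n 60).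
Proof.
move=> le; apply: (fold_bound (encA := VPoint) (encB := VBool)
  (phi := fun l => has (fun q => d p q <= r + r)%R l)) => //.
  by eapply evb_le; [evr; done | bound].
move=> l1 a l' _; eapply evb_le; [evr | bound].
- by rewrite /= H.
- by rewrite /= (negbTE H).
Qed.

Definition far_c n := fold_cost n (60 + fold_cost n 60).

Lemma far_fnb r pts : size pts <= n ->
  fnb far_f (VPair (VReal r) (enc_points pts)) (enc_points (far r pts)) (far_c n).
Proof.
move=> le; apply: (fold_bound (encA := VPoint) (encB := enc_points)
  (phi := fun pts => far r pts)) => //.
  by eapply evb_le; [evr; done | bound].
move=> l1 a l' El; eapply evb_le.
  eapply evb_if; first eapply evb_call; first by ev.
  - apply: near_fnb; apply: leq_trans (far_size _ _) (leq_trans _ le).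
    by rewrite El size_cat /=; apply: leq_trans (leq_addl _ _).
  - by move=> C; evr; rewrite /= C.
  - by move=> C; evr; rewrite /= (negbTE C).
bound.
Qed.

Definition enc_best (o : option (R * seq (X * X))) : value :=
  enc_option (fun rJ => VReal rJ.1) (fun rJ => enc_pairs R rJ.2) o.

Definition best_for_c n := fold_cost n (120 + far_c n + augment_c n).

Lemma best_for_fnb p pts Q acc : size Q <= n -> size pts + size pts + 2 <= n ->
  fnb best_for_f (VPair (VPair (enc_best acc) (VPair (VPoint p)
       (VPair (enc_points pts) (enc_points Q)))) (enc_points Q))
    (enc_best (best_for pts Q p acc Q)) (best_for_c n).
Proof.
move=> sQ sp; apply: (fold_bound (encA := VPoint) (encB := enc_best)
  (phi := fun l => best_for pts Q p acc l)) => //.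
  by eapply evb_le; [evr; done | bound].
move=> l1 q l' El; eapply evb_le.
  eapply evb_let; first by ev.
  eapply (evb_case_option (f := @enc_pairs R X) (g := fun=> VNil)
    (o := attempt pts Q (d p q))).
  - eapply evb_call; first eapply evb_op2; [by ev | eapply evb_call; [by ev|]|reflexivity|].
      by apply: far_fnb; apply: leq_trans sp; rewrite -addnA leq_addr.
    apply: (@augment_fnb R X d M n) => //.
    + exact: far_uniq.
    + by move=> *; apply: far_disjoint; eassumption.
    by apply: leq_trans sp; rewrite leq_add2r leq_add // far_size.
  - by move=> E; evr; rewrite /= E.
  move=> J EJ.
  eapply (evb_case_option (f := fun rJ : R * _ => VReal rJ.1)
    (g := fun rJ => @enc_pairs R X rJ.2) (o := best_for pts Q p acc l')).
  - by ev.
  - by move=> E; evr; rewrite /= EJ E.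
  by move=> rJ E; evr; rewrite /= EJ E /=; [rewrite H|rewrite (negbTE H)].
bound.
Qed.

Definition best_c n := fold_cost n (80 + best_for_c n).

Lemma best_fnb pts Q : size Q <= n -> size pts + size pts + 2 <= n ->
  fnb best_f (VPair (VPair (enc_points pts) (enc_points Q)) (enc_points pts))
    (enc_best (best pts Q pts)) (best_c n).
Proof.
move=> sQ sp; apply: (fold_bound (encA := VPoint) (encB := enc_best)
  (phi := fun l => best pts Q l)) => //.
  by apply: leq_trans sp; rewrite -addnA leq_addr.
  by eapply evb_le; [evr; done | bound].
move=> l1 p l' El; eapply evb_le.
  by eapply evb_call; [ev | apply: best_for_fnb].
bound.
Qed.

End Cost.
End Selection.

(** * Descending the tree *)

Section TreeOps.
Variable X : finType.
Implicit Types (u : etree X) (ns : seq (etree X)).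

(** On a frontier at level [m] no chain ends above [m], so [m <= b] amounts to equality: the chain
    ends at [m] and its children take over. Otherwise the node also stands for its point at level
    [m - 1]. *)
Definition nexts (m : int) u : seq (etree X) :=
  if et_bot u is Some b then if m <= b then et_children u else [:: u] else [:: u].

Definition down m ns : seq (etree X) := foldr (fun u l => nexts m u ++ l) [::] ns.

Definition max_bot ns : option int :=
  foldr (fun u acc =>
    if et_bot u is Some b then
      if acc is Some a then if a <= b then Some b else acc else Some b
    else acc) None ns.

(** The unspent budget is returned so that a single budget serves for all nodes of a level. *)
Fixpoint take_within A B (bud : seq A) (s acc : seq B) {struct s} : option (seq A * seq B) :=
  if s is c :: s' then
    if bud is _ :: bud' then take_within bud' s' (c :: acc) else None
  else Some (bud, acc).

Definition expand_step (A : Type) m u (o : option (seq A * seq (etree X))) :=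
  if o is Some bl then take_within bl.1 (nexts m u) bl.2 else None.

Definition expand (A : Type) m (bud : seq A) ns : option (seq A * seq (etree X)) :=
  foldr (@expand_step A m) (Some (bud, [::])) ns.

Fixpoint refined j (l : int) ns : seq (etree X) :=
  if j is j'.+1 then refined j' (l - 1) (down l ns) else ns.

Lemma take_withinP A B (bud : seq A) (s acc : seq B) :
  match take_within bud s acc with
  | Some bl => bl.2 = rev s ++ acc /\ (size bl.1 + size s = size bud)%N
  | None => (size bud < size s)%N
  end.
Proof.
elim: s bud acc => [|c s IH] [|x bud] acc //=; rewrite ?addn0 //.
have := IH bud (c :: acc); case: take_within => // bl [-> <-].
by rewrite rev_cons cat_rcons addnS.
Qed.

(** Nodes are moved one at a time, so each group of children arrives reversed; up to that order this
    is [down]. *)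
Definition expanded m ns : seq (etree X) := foldr (fun u l => rev (nexts m u) ++ l) [::] ns.

Lemma size_expanded m ns : size (expanded m ns) = size (down m ns).
Proof. by elim: ns => //= u ns IH; rewrite !size_cat size_rev IH. Qed.

Lemma expandP A m (bud : seq A) ns :
  match expand m bud ns with
  | Some bl => bl.2 = expanded m ns /\ (size bl.1 + size bl.2 = size bud)%N
  | None => (size bud < size (down m ns))%N
  end.
Proof.
elim: ns => [|u ns] /=; first by rewrite addn0.
rewrite /expand_step -/(expand m bud ns) size_cat.
case: expand => [[b l] /= [El Es]|lt]; last by apply: leq_trans lt (leq_addl _ _).
have := take_withinP b (nexts m u) l; case: take_within => [bl [-> Eb]|lt].
  by rewrite El size_cat size_rev -El; split=> //; lia.
by move: Es; rewrite El size_expanded; lia.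
Qed.

Lemma max_botP ns :
  match max_bot ns with
  | Some m => (exists2 u, List.In u ns & et_bot u = Some m) /\
      forall u b, List.In u ns -> et_bot u = Some b -> b <= m
  | None => forall u, List.In u ns -> et_bot u = None
  end.
Proof.
elim: ns => [|u ns] //=; rewrite -/(max_bot ns).
case E : (et_bot u) => [b|]; case: (max_bot ns) => [a [[v vns Ev] Ha]|Ha].
- case: (lerP a b) => [ab|ba]; split.
  + by exists u; [left|].
  + move=> w c [<-|wns] Ec; first by move: Ec; rewrite E => -[<-].
    by apply: le_trans ab; exact: Ha Ec.
  + by exists v; [right|].
  + move=> w c [<-|wns] Ec; first by move: Ec; rewrite E => -[<-]; exact: ltW.
    exact: Ha Ec.
- split; first by exists u; [left|].
  move=> w c [<-|wns] Ec; first by move: Ec; rewrite E => -[<-].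
  by move: Ec; rewrite Ha.
- split; first by exists v; [right|].
  by move=> w c [<-|wns] Ec; [rewrite E in Ec | exact: Ha Ec].
- by move=> w [<-//|/Ha].
Qed.

Lemma down_id m ns : (forall u, List.In u ns -> et_bot u = None) -> down m ns = ns.
Proof.
elim: ns => [//|u ns IH] H /=; rewrite IH; last by move=> w wn; apply: H; right.
by rewrite /nexts H; [|left].
Qed.

Lemma refined_id j l ns : (forall u, List.In u ns -> et_bot u = None) -> refined j l ns = ns.
Proof. by move=> H; elim: j l => [//|j IH] l /=; rewrite down_id. Qed.

End TreeOps.

(** * Cost of the tree operations *)

Section TreeCost.
Local Open Scope nat_scope.
Variables (R : realType) (X : finType) (d : X -> X -> R) (M : matroid X).
Local Notation value := (value R X).
Local Notation fnb := (fnb d M functions_text).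
Local Notation evb := (evb d M functions_text).
Local Notation enc_tree := (@enc_etree R X).

Definition enc_trees (ns : seq (etree X)) : value := enc_seq [seq enc_tree u | u <- ns].

Lemma enc_etreeE u : enc_tree u =
  VPair (VPoint (et_point u)) (VPair (VInt (et_top u))
    (VPair (enc_option VInt (fun=> VNil) (et_bot u)) (VPair (VInt (et_weight u)%:Z)
    (VPair (enc_points (et_mis u)) (VPair (enc_trees (et_children u)) VNil))))).
Proof. by case: u => p t [b|] w s cs. Qed.

Variable n : nat.

Lemma app_fnb A (enc : A -> value) s acc : size s <= n ->
  fnb app_f (VPair (enc_seq [seq enc a | a <- acc]) (enc_seq [seq enc a | a <- s]))
    (enc_seq [seq enc a | a <- s ++ acc]) (fold_cost n 60).
Proof.
move=> le; apply: (fold_bound (encA := enc) (encB := fun s => enc_seq [seq enc a | a <- s])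
  (phi := fun s => s ++ acc)) => //.
  by eapply evb_le; [evr; done | bound].
by move=> l1 a l' _; eapply evb_le; [evr | bound].
Qed.

Lemma points_fnb v ns : size ns <= n ->
  fnb points_f (VPair v (enc_trees ns)) (enc_points [seq et_point u | u <- ns])
    (fold_cost n 60).
Proof.
move=> le; apply: (fold_bound (encA := enc_tree) (encB := enc_points)
  (phi := fun ns => [seq et_point u | u <- ns])) => //.
  by eapply evb_le; [evr; done | bound].
by move=> l1 u l' _; rewrite enc_etreeE; eapply evb_le; [evr | bound].
Qed.

Definition all_mis_c n := fold_cost n (60 + fold_cost n 60).

Lemma all_mis_fnb v ns : size ns <= n ->
  (forall u, List.In u ns -> size (et_mis u) <= n) ->
  fnb all_mis_f (VPair v (enc_trees ns)) (enc_points (flatten [seq et_mis u | u <- ns]))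
    (all_mis_c n).
Proof.
move=> le lem; apply: (fold_bound (encA := enc_tree) (encB := enc_points)
  (phi := fun ns => flatten [seq et_mis u | u <- ns])) => //.
  by eapply evb_le; [evr; done | bound].
move=> l1 u l' El; rewrite enc_etreeE; eapply evb_le.
  eapply evb_call; first by ev.
  apply: (app_fnb VPoint); apply: lem; rewrite El; apply/List.in_or_app.
  by right; left.
bound.
Qed.

Lemma max_bot_fnb v ns : size ns <= n ->
  fnb max_bot_f (VPair v (enc_trees ns)) (enc_option VInt (fun=> VNil) (max_bot ns))
    (fold_cost n 60).
Proof.
move=> le; apply: (fold_bound (encA := enc_tree)
  (encB := enc_option VInt (fun=> VNil)) (phi := @max_bot X)) => //.
  by eapply evb_le; [evr; done | bound].
move=> l1 u l' El; rewrite enc_etreeE; eapply evb_le.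
  eapply (evb_case_option (f := VInt) (g := fun=> VNil) (o := et_bot u)).
  - by ev.
  - by move=> E; evr; rewrite /= E.
  move=> b E; eapply (evb_case_option (f := VInt) (g := fun=> VNil) (o := max_bot l')).
  - by ev.
  - by move=> E'; evr; rewrite /= E -/(max_bot l') E'.
  by move=> a E'; evr; rewrite /= E -/(max_bot l') E'; [rewrite H|rewrite (negbTE H)].
bound.
Qed.

Lemma nexts_fnb m u :
  fnb nexts_f (VPair (VInt m) (enc_tree u)) (enc_trees (nexts m u)) 40.
Proof.
rewrite (enc_etreeE u); eapply fnb_intro; [reflexivity | unfold nexts_b |].
  eapply (evb_case_option (f := VInt) (g := fun=> VNil) (o := et_bot u)).
  - by ev.
  - move=> E; evr; have -> : nexts m u = [:: u] by rewrite /nexts E.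
    exact: (congr1 (fun v => VPair v VNil) (esym (enc_etreeE u))).
  move=> b E; evr.
    by have -> : nexts m u = et_children u by rewrite /nexts E H.
  have -> : nexts m u = [:: u] by rewrite /nexts E (negbTE H).
  exact: (congr1 (fun v => VPair v VNil) (esym (enc_etreeE u))).
bound.
Qed.

Definition enc_taken (o : option (seq X * seq (etree X))) : value :=
  enc_option (fun bl => enc_points bl.1) (fun bl => enc_trees bl.2) o.

(** Each unit of budget prepays thirty steps. The cost of expanding a level is thus linear in the
    budget and the number of nodes, however many children there are; an aborted expansion keeps no
    credit. *)
Definition taken_potential (o : option (seq X * seq (etree X))) :=
  if o is Some bl then 30 * size bl.1 else 0.

Lemma take_fnb bud s acc :
  exists2 B, fnb take_f (VPair (enc_points bud) (VPair (enc_trees s) (enc_trees acc)))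
    (enc_taken (take_within bud s acc)) B &
    B + taken_potential (take_within bud s acc) <= 30 + 30 * size bud.
Proof.
elim: s bud acc => [|c s IH] bud acc.
  exists 30; last exact: leqnn.
  eapply fnb_intro; [reflexivity | unfold take_b |].
    eapply (evb_case_list (f := enc_tree) (s := [::]) (B2 := 0)); [by ev| |by []].
    by move=> _; evr.
  bound.
case: bud => [|x bud].
  exists 30; last exact: leqnn.
  eapply fnb_intro; [reflexivity | unfold take_b |].
    eapply (evb_case_list (f := enc_tree) (s := c :: s) (B1 := 0)); [by ev|by []|].
    move=> _ _ [<- <-].
    eapply (evb_case_list (f := VPoint) (s := [::]) (B2 := 0)); [by ev| |by []].
    by move=> _; evr.
  bound.
have [B HB le] := IH bud (c :: acc).
exists (30 + B); last by rewrite /= mulnS; move: le; clear; lia.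
eapply fnb_intro; [reflexivity | unfold take_b |].
  eapply (evb_case_list (f := enc_tree) (s := c :: s) (B1 := 0)); [by ev|by []|].
  move=> _ _ [<- <-].
  eapply (evb_case_list (f := VPoint) (s := x :: bud) (B1 := 0)); [by ev|by []|].
  move=> _ _ [<- <-].
  by eapply evb_call; [ev | exact: HB].
bound.
Qed.

Lemma expand_fnb m bud ns :
  fnb expand_f (VPair (VPair (VInt m) (enc_points bud)) (enc_trees ns))
    (enc_taken (expand m bud ns)) (100 + 30 * size bud + 200 * size ns).
Proof.
have [||B HB le] := @fold_potential R X d M functions_text expand_f
    _ _ (VPair (VInt m) (enc_points bud)) _ _ enc_tree enc_taken
    (expand m bud) taken_potential 40 150 ns erefl.
- by eapply evb_le; [evr; done | bound].
- move=> l1 u l' El.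
  case Eo : (expand m bud l') => [[b l]|].
    have [B HB le] := take_fnb b (nexts m u) l.
    exists (80 + B); last by rewrite /= -/(expand m bud l') Eo /=; move: le; clear; lia.
    eapply evb_le.
      eapply (evb_case_option (f := fun bl : _ * _ => enc_points bl.1)
        (g := fun bl : _ * _ => enc_trees bl.2) (o := Some (b, l)) (B1 := 0)); [by ev|by []|].
      move=> _ [<-]; eapply evb_eq.
        eapply evb_call; first eapply evb_op2; [by ev| |reflexivity|exact: HB].
        eapply evb_op2; [|by ev|reflexivity].
        by eapply evb_call; [ev | exact: nexts_fnb].
      by rewrite /= -/(expand m bud l') Eo.
    bound.
  exists 40; last by rewrite /= -/(expand m bud l') Eo /=; bound.
  eapply evb_le.
    eapply (evb_case_option (f := fun bl : seq X * seq (etree X) => enc_points bl.1)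
      (g := fun bl => enc_trees bl.2) (o := None) (B2 := 0)); [by ev| |by []].
    by move=> _; evr; rewrite /= -/(expand m bud l') Eo.
  bound.
apply: fnb_le HB _; move: le; rewrite /=; lia.
Qed.

Definition down_c n := fold_cost n (80 + fold_cost n 60).

Lemma down_fnb m ns : size ns <= n -> size (down m ns) <= n ->
  fnb down_f (VPair (VInt m) (enc_trees ns)) (enc_trees (down m ns)) (down_c n).
Proof.
move=> le led; apply: (fold_bound (encA := enc_tree) (encB := enc_trees)
  (phi := fun ns => down m ns)) => //.
  by eapply evb_le; [evr; done | bound].
move=> l1 u l' El; eapply evb_le.
  eapply evb_call; first eapply evb_op2; [by ev| |reflexivity|].
    by eapply evb_call; [ev | exact: nexts_fnb].
  apply: (app_fnb enc_tree); apply: leq_trans led; rewrite El.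
  by elim: (l1) => [|v l IH] /=; rewrite size_cat; [exact: leq_addr | apply: leq_trans IH (leq_addl _ _)].
bound.
Qed.

Definition refine_c n j := 20 + j * (60 + down_c n).

Lemma refine_fnb j (e : R) l ns :
  (forall i, i <= j -> size (refined i l ns) <= n) ->
  (1 <= e * 2 ^+ j)%R -> (forall i, i < j -> (e * 2 ^+ i < 1)%R) ->
  fnb refine_f (VPair (VReal e) (VPair (VInt l) (enc_trees ns))) (enc_trees (refined j l ns))
    (refine_c n j).
Proof.
elim: j e l ns => [|j IH] e l ns sz ge lt.
  eapply fnb_intro; [reflexivity | unfold refine_b |].
    eapply (evb_if (B2 := 0)); [by ev | by move=> _; evr | ].
    by rewrite /= -(mulr1 e) -(expr0 2%:R) ge.
  rewrite /refine_c mul0n; bound.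
have dbl i : ((e + e) * 2 ^+ i = e * 2 ^+ i.+1)%R by rewrite exprS mulrA mulr_natr mulr2n.
have e1 : (e < 1)%R by have := lt 0 isT; rewrite expr0 mulr1.
eapply fnb_intro; [reflexivity | unfold refine_b |].
  eapply (evb_if (B1 := 0)); [by ev | by move=> /= h; move: e1; rewrite ltNge h |].
  move=> _; eapply evb_call.
    eapply evb_op2; [by ev| |reflexivity].
    eapply evb_op2; [by ev| |reflexivity].
    eapply evb_call; first by ev.
    by apply: down_fnb; [exact: (sz 0) | exact: (sz 1)].
  apply: IH => /=.
  - by move=> i le; apply: (sz i.+1).
  - by rewrite dbl.
  - by move=> i ltj; rewrite dbl; apply: lt.
rewrite /refine_c mulSn; bound.
Qed.

End TreeCost.

Lemma In_cat A (x : A) (s1 s2 : seq A) :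
  List.In x (s1 ++ s2) <-> List.In x s1 \/ List.In x s2.
Proof.
by elim: s1 => [|y s1 IH] /=; [split=> [|[]//]; right | rewrite IH; tauto].
Qed.

(** * Frontiers of the cover tree *)

Section Frontier.
Variables (R : realType) (X : finType) (d : X -> X -> R) (M : matroid X).
Hypothesis d_refl : forall p, d p p = 0.
Hypothesis d_sym : forall p q, d p q = d q p.
Hypothesis d_tri : forall q p s, d p s <= d p q + d q s.
Variable T : cover_tree d.
Implicit Types (l m b : int) (u : etree X) (ns : seq (etree X)).

Lemma level_le_top l p : p \in ct_level T l -> l <= ct_top T.
Proof.
by move=> pl; rewrite leNgt; apply/negP => /ct_above_root E; rewrite E inE in pl.
Qed.

Lemma not_root l p : l < ct_top T -> (l, p) != (ct_top T, ct_root T).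
Proof. by move=> lt; rewrite xpair_eqE negb_and lt_eqF. Qed.

Lemma subr1_addr1 l : l - 1 + 1 = l. Proof. by rewrite subrK. Qed.

(** The parent is within [2 ^ l] of [p] by covering, and both lie in level [l], where distinct
    points are farther apart than that. *)
Lemma parent_self l p : p \in ct_level T l -> ct_parent T (l - 1) p = p.
Proof.
move=> pl; have lt : l - 1 < ct_top T.
  by apply: lt_le_trans (level_le_top pl); rewrite ltrBlDr ltrDl.
have pl1 : p \in ct_level T (l - 1) by move: p pl {lt}; apply/subsetP; exact: ct_nesting.
have := ct_parent_level pl1 (not_root p lt).
have := ct_covering pl1 (not_root p lt); rewrite subr1_addr1 => le ql.
apply/eqP; apply: contraTT le => ne; rewrite -ltNge.
by apply: (@ct_separation _ _ _ T l p (ct_parent T (l - 1) p)) => //; rewrite eq_sym.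
Qed.

Lemma self_child l p : p \in ct_level T l -> p \in ct_children T l p.
Proof.
move=> pl; rewrite inE parent_self // eqxx andbT.
by move: p pl; apply/subsetP; exact: ct_nesting.
Qed.

Lemma child_parent l q : l <= ct_top T -> q \in ct_level T (l - 1) ->
  ct_parent T (l - 1) q \in ct_level T l /\ q \in ct_children T l (ct_parent T (l - 1) q).
Proof.
move=> le ql; rewrite inE ql eqxx; split=> //.
have lt : l - 1 < ct_top T by apply: lt_le_trans le; rewrite ltrBlDr ltrDl.
by have := ct_parent_level ql (not_root q lt); rewrite subr1_addr1.
Qed.

Lemma child_dist l p q : l <= ct_top T -> q \in ct_children T l p -> d p q <= 2 ^ l.
Proof.
move=> le; rewrite inE => /andP[ql /eqP <-].
have lt : l - 1 < ct_top T by apply: lt_le_trans le; rewrite ltrBlDr ltrDl.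
by rewrite d_sym; have := ct_covering ql (not_root q lt); rewrite subr1_addr1.
Qed.

Lemma level_sub l (j : nat) : ct_level T l \subset ct_level T (l - j%:Z).
Proof.
elim: j => [|j IH]; first by rewrite subr0.
apply: subset_trans IH _; rewrite -addn1 PoszD opprD addrA; exact: ct_nesting.
Qed.

Lemma level_le l m : m <= l -> ct_level T l \subset ct_level T m.
Proof.
move=> le; have -> : m = l - `|l - m|%N%:Z by rewrite gez0_abs ?subr_ge0 // subKr.
exact: level_sub.
Qed.

Lemma explicit_inv u : explicit_node T u ->
  [/\ et_point u \in ct_level T (et_top u),
      forall b, et_bot u = Some b ->
        [/\ b <= et_top u,
            forall l, b < l <= et_top u -> only_self_child T l (et_point u),
            ~~ (only_self_child T b (et_point u) && only_self_child T (b - 1) (et_point u)),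
            uniq [seq et_point c | c <- et_children u] /\
            [seq et_point c | c <- et_children u] =i ct_children T b (et_point u) &
            forall c, List.In c (et_children u) -> et_top c = b - 1],
      et_bot u = None -> (forall l, l <= et_top u -> only_self_child T l (et_point u)) /\
        et_children u = [::] &
      forall c, List.In c (et_children u) -> explicit_node T c].
Proof. by case=> {}u pl; case: (et_bot u) => [b|] H Hc; split=> // b' [<-]. Qed.

Lemma augmented_inv u : augmented M u ->
  [/\ et_weight u = #|[set q in subtree_points u]|, uniq (et_mis u),
      is_mis M [set q in subtree_points u] [set q in et_mis u] &
      forall c, List.In c (et_children u) -> augmented M c].
Proof. by case=> v *; split. Qed.

Lemma subtree_pointsE u :
  subtree_points u = et_point u :: flatten [seq subtree_points c | c <- et_children u].
Proof. by case: u. Qed.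

Lemma mem_flatten_map (A : Type) (f : A -> seq X) (s : seq A) q :
  q \in flatten [seq f a | a <- s] <-> exists2 a, List.In a s & q \in f a.
Proof.
elim: s => [|a s IH] /=; first by split=> // -[].
rewrite mem_cat; split=> [/orP[qa|/IH[a' a's qa']]|[a' [->|a's] qa']].
- by exists a => //; left.
- by exists a' => //; right.
- by rewrite qa'.
- by apply/orP; right; apply/IH; exists a'.
Qed.

Lemma map_in (A : Type) (f : A -> X) (s : seq A) q :
  q \in [seq f a | a <- s] <-> exists2 a, List.In a s & q = f a.
Proof.
elim: s => [|a s IH] /=; first by split=> // -[].
rewrite inE; split=> [/orP[/eqP ->|/IH[a' a's ->]]|[a' [->|a's] Eq]].
- by exists a => //; left.
- by exists a' => //; right.
- by rewrite Eq eqxx.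
- by apply/orP; right; apply/IH; exists a'.
Qed.

(* The nodes [ns] stand for the level l, each through the chain that contains it. *)
Definition front l ns :=
  [/\ l <= ct_top T, uniq [seq et_point u | u <- ns],
      [seq et_point u | u <- ns] =i ct_level T l &
      forall u, List.In u ns -> [/\ explicit_node T u, augmented M u, l <= et_top u &
        forall b, et_bot u = Some b -> b <= l]].

Lemma front_size l ns : front l ns -> size ns = #|ct_level T l|.
Proof.
move=> [_ un E _]; rewrite -(size_map (@et_point X) ns) -(card_uniqP un).
by apply: eq_card.
Qed.

Lemma front_eq l ns ns' : front l ns ->
  perm_eq [seq et_point u | u <- ns] [seq et_point u | u <- ns'] ->
  (forall u, List.In u ns' -> List.In u ns) -> front l ns'.
Proof.
case=> le un E H pe sub; split; first exact: le.
- by rewrite -(perm_uniq pe).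
- by move=> q; rewrite -(perm_mem pe).
- by move=> u /sub un'; exact: H.
Qed.

Lemma nexts_points l ns u : front l ns -> List.In u ns ->
  uniq [seq et_point c | c <- nexts l u] /\
  [seq et_point c | c <- nexts l u] =i ct_children T l (et_point u).
Proof.
move=> [le un E H] uns; have [ex _ lu bu] := H _ uns.
have [pu Hs Hn _] := explicit_inv ex.
have self : only_self_child T l (et_point u) ->
    uniq [seq et_point c | c <- [:: u]] /\
    [seq et_point c | c <- [:: u]] =i ct_children T l (et_point u).
  by move=> /eqP ->; split=> // q; rewrite !inE.
rewrite /nexts; case Eb : (et_bot u) => [b|]; last first.
  by apply: self; have [os _] := Hn Eb; exact: os.
have [bt os _ uc _] := Hs _ Eb; have bl := bu _ Eb.
case: (lerP l b) => lb; last by apply: self; apply: os; rewrite lb.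
by have -> : l = b by apply/eqP; rewrite eq_le lb bl.
Qed.

Lemma In_down l ns u : List.In u (down l ns) -> exists2 v, List.In v ns & List.In u (nexts l v).
Proof.
elim: ns => [//|v ns IH] /= /In_cat[uv|/IH[w wns uw]].
  by exists v; [left|].
by exists w; [right|].
Qed.

Lemma In_nexts l u c : List.In c (nexts l u) ->
  (c = u /\ forall b, et_bot u = Some b -> b < l) \/
  List.In c (et_children u) /\ (exists2 b, et_bot u = Some b & l <= b).
Proof.
rewrite /nexts; case: (et_bot u) => [b|] /=; last by case=> // ->; left.
case: (lerP l b) => lb /=; first by right; split=> //; exists b.
by case=> // ->; left; split=> // _ [<-].
Qed.

(** Every point of level [l - 1] is a child of exactly one point of level [l], so concatenating the
    children lists that level without repetition. *)
Lemma front_down l ns : front l ns -> front (l - 1) (down l ns).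
Proof.
move=> F; have [le un E H] := F.
have HP u : List.In u ns -> et_point u \in ct_level T l.
  by move=> uns; rewrite -E; apply/map_in; exists u.
have K ns' : (forall u, List.In u ns' -> List.In u ns) ->
    uniq [seq et_point u | u <- ns'] ->
    uniq [seq et_point u | u <- down l ns'] /\
    (forall q, q \in [seq et_point u | u <- down l ns'] <->
       exists2 u, List.In u ns' & q \in ct_children T l (et_point u)).
  elim: ns' => [|u ns' IH] sub /=; first by split=> // q; split=> // -[].
  move=> /andP[nu un']; have [||ud md] := IH => //.
    by move=> w wn; apply: sub; right.
  have [uu mu] := nexts_points F (sub u (or_introl erefl)).
  rewrite map_cat cat_uniq uu ud andbT /=; split.
    apply/hasPn => q /md[w wns qw]; rewrite mu.
    apply: contra nu; rewrite inE => /andP[_ /eqP Eu].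
    move: qw; rewrite inE => /andP[_ /eqP]; rewrite Eu => ->.
    by apply/map_in; exists w.
  move=> q; rewrite mem_cat mu; split=> [/orP[qu|/md[w wn qw]]|[w [<-|wn] qw]].
  - by exists u => //; left.
  - by exists w => //; right.
  - by rewrite qw.
  - by apply/orP; right; apply/md; exists w.
have [ud md] := K ns (fun _ h => h) un; split.
- by apply: le_trans le; rewrite lerBlDr lerDl.
- exact: ud.
- move=> q; apply/idP/idP => [/md[u uns]|ql].
    by rewrite inE => /andP[].
  have [pl pc] := child_parent le ql.
  by apply/md; move: pl; rewrite -E => /map_in[u uns Eu]; exists u => //; rewrite -Eu.
move=> c /In_down[u uns]; have [ex au lu bu] := H _ uns.
case/In_nexts => [[-> lt]|[cu [b Eb lb]]].
  split=> //; first by apply: le_trans lu; rewrite lerBlDr lerDl.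
  by move=> b /lt; rewrite lerBrDr lezD1.
have [_ Hs _ Hc] := explicit_inv ex; have [_ _ _ _ Ht] := Hs _ Eb.
have -> : l = b by apply/eqP; rewrite eq_le lb bu.
split; [exact: Hc| |by rewrite (Ht _ cu)|].
  by have [_ _ _ Ha] := augmented_inv au; exact: Ha.
by move=> b' Eb'; have [_ /(_ _ Eb')[]] := explicit_inv (Hc _ cu); rewrite (Ht _ cu).
Qed.

Lemma down_stay l ns : (forall u b, List.In u ns -> et_bot u = Some b -> b < l) ->
  down l ns = ns.
Proof.
elim: ns => [//|u ns IH] H /=; rewrite IH; last by move=> w b wn; apply: H; right.
have := H u; rewrite /nexts; case: et_bot => [b|//] /(_ b (or_introl erefl) erefl) lt.
by rewrite leNgt lt.
Qed.

(** This justifies the jump over levels without branching: no chain ends above [m], so each skipped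
    round of [down] would change nothing. *)
Lemma front_stay l m ns : front l ns -> m <= l ->
  (forall u b, List.In u ns -> et_bot u = Some b -> b <= m) -> front m ns.
Proof.
move=> F le bm; have -> : m = l - `|l - m|%N%:Z by rewrite gez0_abs ?subr_ge0 // subKr.
have : (`|l - m|%N%:Z <= l - m) by rewrite gez0_abs ?subr_ge0.
elim: `|l - m|%N => [|j IH] lej; first by rewrite subr0.
have Fj : front (l - j%:Z) ns by apply: IH; lia.
have := front_down Fj; rewrite down_stay; last first.
  by move=> u b un Eb; have := bm _ _ un Eb; lia.
by rewrite -addn1 PoszD opprD addrA.
Qed.

(** A chain adds no distance; only the level [b] at which it ends counts. A child is within [2 ^ b],
    and by induction at level [b - 1] its subtree is within [2 ^ b] of it, which sums to
    [2 ^ (b + 1)]. *)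
Lemma explicit_cov u : explicit_node T u -> forall l q,
  (forall b, et_bot u = Some b -> b <= l) -> q \in subtree_points u ->
  d (et_point u) q <= 2 ^ (l + 1).
Proof.
elim=> {}u pu Hb Hc IH l q bl; rewrite subtree_pointsE inE => /orP[/eqP ->|].
  by rewrite d_refl exprz_ge0.
case/mem_flatten_map => c cu qc.
case Eb : (et_bot u) Hb => [b|] Hb; last by case: Hb => _ E; rewrite E in cu.
have [bt os _ [_ Ec] tc] := Hb.
have pc : et_point c \in ct_children T b (et_point u).
  by rewrite -Ec; apply/map_in; exists c.
have bt' : b <= ct_top T := le_trans bt (level_le_top pu).
have bl' := bl _ Eb.
have dc := IH c cu (b - 1) q _ qc; rewrite subr1_addr1 in dc.
apply: le_trans (d_tri (et_point c) _ _) _.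
have : d (et_point u) (et_point c) + d (et_point c) q <= 2 ^ b + 2 ^ b.
  apply: lerD; first exact: child_dist.
  apply: dc => b' Eb'; rewrite -(tc _ cu).
  by have [_ /(_ _ Eb')[]] := explicit_inv (Hc _ cu).
move=> H; apply: le_trans H _.
have -> : (2 : R) ^ b + 2 ^ b = 2 ^ (b + 1).
  by rewrite exprzDr ?unitfE ?pnatr_eq0 // expr1z mulr_natr mulr2n.
by rewrite ler_eXz2l ?ltr1n // lerD2r.
Qed.

Lemma front_cov l ns u q : front l ns -> List.In u ns -> q \in subtree_points u ->
  d (et_point u) q <= 2 ^ (l + 1).
Proof. by case=> _ _ _ H /H[ex _ _ bl]; exact: explicit_cov. Qed.

Lemma front_total l ns q : front l ns -> exists2 u, List.In u ns & q \in subtree_points u.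
Proof.
have [m qm] := ct_all_points T q.
have K j l' ns' : front l' ns' -> q \in ct_level T (l' - j%:Z) ->
    exists2 u, List.In u ns' & q \in subtree_points u.
  elim: j l' ns' => [|j IH] l' ns' F; rewrite ?subr0.
    case: (F) => _ _ <- _ /map_in[u un ->]; exists u => //.
    by rewrite subtree_pointsE inE eqxx.
  move=> ql; have [|u /In_down[v vn uv] qu] := IH _ _ (front_down F).
    by move: ql; rewrite -addn1 PoszD opprD addrAC addrA.
  exists v => //; case/In_nexts: uv => [[<- //]|[uv _]].
  by rewrite subtree_pointsE inE; apply/orP; right; apply/mem_flatten_map; exists u.
(* The level reached after [|l - m|] descents is at or below [m] whichever of the two is larger, and
   nesting keeps [q] in it. *)
move=> F; apply: (K `|l - m|%N _ _ F).
by move: q qm {K}; apply/subsetP; apply: level_le; lia.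
Qed.

Lemma root_front u : explicit_representation T u -> augmented M u -> front (ct_top T) [:: u].
Proof.
move=> [Ep Et ex] au; split=> [||q|v] /=; [exact: lexx|by []| |].
  rewrite !inE Ep; apply/eqP/idP => [->|ql]; first exact: ct_root_level.
  apply/eqP; apply: contraT => ne.
  have nr : (ct_top T, q) != (ct_top T, ct_root T) by rewrite xpair_eqE eqxx.
  have := ct_parent_level ql nr; rewrite ct_above_root ?inE //.
  by rewrite ltrDl.
case=> [<-|//]; split; [exact: ex|exact: au|by rewrite Et|].
by move=> b Eb; have [_ /(_ _ Eb)[]] := explicit_inv ex; rewrite Et.
Qed.

(** The representation may end a chain one level above the branching node, so the branching is at
    [b] or at [b - 1]. A child with another point is covered at that level and separated from its
    parent at the level below; the interval is the union of the two cases. *)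
Lemma front_branch l ns u b : front l ns -> List.In u ns -> et_bot u = Some b ->
  exists p q, [/\ p != q, 2 ^ (b - 2) < d p q & d p q <= 2 ^ b].
Proof.
move=> [le _ E H] uns Eb; have [ex _ lu bu] := H _ uns.
have bl := bu _ Eb.
have [pu Hs _ _] := explicit_inv ex; have [bt _ ns1 _ _] := Hs _ Eb.
have K c : c <= l -> et_point u \in ct_level T c -> ~~ only_self_child T c (et_point u) ->
    exists p q, [/\ p != q, 2 ^ (c - 1) < d p q & d p q <= 2 ^ c].
  move=> cl pc; rewrite /only_self_child => nos.
  have ct : c <= ct_top T := le_trans cl le.
  have [q qc qp] : exists2 q, q \in ct_children T c (et_point u) & q != et_point u.
    have : ~~ (ct_children T c (et_point u) \subset [set et_point u]).
      apply: contra nos => sub; rewrite eqEsubset sub sub1set; exact: self_child.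
    by case/subsetPn => q qc; rewrite inE; exists q.
  exists (et_point u), q; split; [by rewrite eq_sym| |exact: child_dist].
  have qc' : q \in ct_level T (c - 1) by move: qc; rewrite inE => /andP[].
  apply: (ct_separation _ qc'); last by rewrite eq_sym.
  by move: (et_point u) pc; apply/subsetP; exact: ct_nesting.
have pb : et_point u \in ct_level T b.
  by move: (et_point u) pu; apply/subsetP; apply: level_le.
move: ns1; rewrite negb_and => /orP[n1|n2].
  have [p [q [pq lt le']]] := K b bl pb n1; exists p, q; split=> //.
  apply: le_lt_trans lt; rewrite ler_eXz2l ?ltr1n //; lia.
have pb1 : et_point u \in ct_level T (b - 1).
  by move: (et_point u) pb; apply/subsetP; exact: ct_nesting.
have b1l : b - 1 <= l by lia.
have [p [q [pq lt le']]] := K (b - 1) b1l pb1 n2; exists p, q; split=> //.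
  by apply: le_lt_trans lt; rewrite ler_eXz2l ?ltr1n //; lia.
by apply: le_trans le' _; rewrite ler_eXz2l ?ltr1n //; lia.
Qed.

Lemma perm_expanded m ns :
  perm_eq [seq et_point u | u <- down m ns] [seq et_point u | u <- expanded m ns].
Proof.
elim: ns => //= u ns IH; rewrite !map_cat; apply: perm_cat => //.
by rewrite map_rev perm_sym perm_rev.
Qed.

Lemma In_expanded m ns u : List.In u (expanded m ns) -> List.In u (down m ns).
Proof.
elim: ns => //= v ns IH /In_cat[h|h]; apply/In_cat; [left|right].
  by elim: (nexts m v) h => //= w s IHs; rewrite rev_cons -cats1 => /In_cat[/IHs|[->|//]];
    [right|left].
exact: IH.
Qed.

Lemma front_refined j l ns : front l ns -> front (l - j%:Z) (refined j l ns).
Proof.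
elim: j l ns => [|j IH] l ns F; first by rewrite subr0.
have -> : l - j.+1%:Z = l - 1 - j%:Z by clear; lia.
exact: (IH _ _ (front_down F)).
Qed.

(** [lo] and [hi] delimit the levels at which a chain can end. Each round jumps to the highest such
    level [m] on the frontier and continues at [m - 1], so [N], which bounds the levels of the range
    still ahead, decreases. The descent stops with no branching left, or at [m] because level
    [m - 1] exceeds the budget. *)
Lemma coarse_fnb (lo hi : int) (bud : seq X) N l ns :
  (forall p q b, p != q -> 2 ^ (b - 2) < d p q -> d p q <= 2 ^ b -> lo <= b <= hi) ->
  (forall b, b <= l -> b <= hi -> b < lo + N%:Z) ->
  front l ns -> (size ns <= size bud)%N ->
  exists m ns', [/\
    fnb d M functions_text coarse_f (VPair (enc_points bud) (enc_trees R ns))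
      (VPair (VInt m) (enc_trees R ns')) (500 * (size bud).+1 * N.+1)%N,
    (size ns' <= size bud)%N &
    (exists2 l', front l' ns' & forall u, List.In u ns' -> et_bot u = None) \/
    (front m ns' /\ (size bud < #|ct_level T (m - 1)|)%N)].
Proof.
move=> range; elim: N l ns => [|N IH] l ns lN F le.
  have Eb : max_bot ns = None.
    have := max_botP ns; case: max_bot => [m|//] [[u un Eu] _].
    have [p [q [pq lt1 lt2]]] := front_branch F un Eu.
    have /andP[h1 h2] := range _ _ _ pq lt1 lt2.
    have [_ _ _ /(_ _ un)[_ _ _ /(_ _ Eu) h3]] := F.
    by have := lN _ h3 h2; rewrite addr0 ltNge h1.
  exists 0, ns; split=> //; last first.
    by left; exists l => //; have := max_botP ns; rewrite Eb.
  eapply fnb_intro; [reflexivity | unfold coarse_b |].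
    eapply (evb_case_option (f := VInt) (g := fun=> VNil) (o := max_bot ns) (B2 := 0%N)).
    - by eapply evb_call; [ev | apply: max_bot_fnb le].
    - by move=> _; evr.
    by rewrite Eb.
  rewrite /fold_cost; lia.
have := max_botP ns; case Em : (max_bot ns) => [m|] Hm; last first.
  exists 0, ns; split=> //; last by left; exists l.
  eapply fnb_intro; [reflexivity | unfold coarse_b |].
    eapply (evb_case_option (f := VInt) (g := fun=> VNil) (o := max_bot ns) (B2 := 0%N)).
    - by eapply evb_call; [ev | apply: max_bot_fnb le].
    - by move=> _; evr.
    by rewrite Em.
  rewrite /fold_cost; nia.
case: Hm => -[u un Eu] Hm.
have [p [q [pq lt1 lt2]]] := front_branch F un Eu.
have /andP[lom mhi] := range _ _ _ pq lt1 lt2.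
have [_ _ _ /(_ _ un)[_ _ _ /(_ _ Eu) ml]] := F.
have Fm : front m ns by apply: front_stay F ml Hm.
have Fd := front_down Fm.
have cost_expand := expand_fnb d M m bud ns.
have := expandP m bud ns; case Ee : expand => [[bud' ns']|]; last first.
  rewrite (front_size Fd) => ltk.
  exists m, ns; split=> //; last by right.
  eapply fnb_intro; [reflexivity | unfold coarse_b |].
    eapply (evb_case_option (f := VInt) (g := fun=> VNil) (o := max_bot ns) (B1 := 0%N)).
    - by eapply evb_call; [ev | apply: max_bot_fnb le].
    - by rewrite Em.
    move=> m'; rewrite Em => -[<-].
    eapply (evb_case_option (f := fun bl : _ * _ => enc_points bl.1)
        (g := fun bl : _ * _ => enc_trees R bl.2) (o := expand m bud ns) (B2 := 0%N)).
    - by eapply evb_call; [ev | exact: cost_expand].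
    - by move=> _; evr.
    by rewrite Ee.
  rewrite /fold_cost; nia.
move=> [/= En Es].
have F' : front (m - 1) ns'.
  by apply: front_eq Fd _ _; rewrite En; [exact: perm_expanded | exact: In_expanded].
have [|||m'' [ns'' [ev'' le'' H'']]] := IH (m - 1) ns'.
- by move=> b bm bhi; have := lN m ml mhi; lia.
- exact: F'.
- by rewrite -Es leq_addl.
exists m'', ns''; split=> //.
eapply fnb_intro; [reflexivity | unfold coarse_b |].
  eapply (evb_case_option (f := VInt) (g := fun=> VNil) (o := max_bot ns) (B1 := 0%N)).
  - by eapply evb_call; [ev | apply: max_bot_fnb le].
  - by rewrite Em.
  move=> m'; rewrite Em => -[<-].
  eapply (evb_case_option (f := fun bl : _ * _ => enc_points bl.1)
      (g := fun bl : _ * _ => enc_trees R bl.2) (o := expand m bud ns) (B1 := 0%N)).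
  - by eapply evb_call; [ev | exact: cost_expand].
  - by rewrite Ee.
  move=> bl; rewrite Ee => -[<-].
  by eapply evb_call; [ev | exact: ev''].
rewrite /fold_cost; nia.
Qed.

End Frontier.

(** * Doubling and radii *)

Section Packing.
Variables (R : realType) (U : metricType R) (S : {fset U}).

Lemma fdist_refl (p : S) : fdist p p = 0. Proof. exact: mdistxx. Qed.

Lemma fdist_ge0 (p q : S) : 0 <= fdist p q. Proof. exact: mdist_ge0. Qed.

Lemma fdist_sym (p q : S) : fdist p q = fdist q p. Proof. exact: metric_sym. Qed.

Lemma fdist_tri (q p s : S) : fdist p s <= fdist p q + fdist q s.
Proof. exact: metric_triangle. Qed.

Lemma fdist_gt0 (p q : S) : p != q -> 0 < fdist p q.
Proof.
move=> pq; rewrite lt_neqAle fdist_ge0 andbT eq_sym; apply: contra pq => /eqP E.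
by apply/eqP/val_inj/mdist_positivity.
Qed.

Lemma card_cover (X : finType) (I : eqType) (l : seq I) (A : {set X}) (P : I -> pred X) (K : R) :
  (forall a, a \in A -> exists2 i, i \in l & P i a) ->
  (forall i, i \in l -> #|[set a in A | P i a]|%:R <= K) ->
  #|A|%:R <= (size l)%:R * K.
Proof.
elim: l A => [|i l IH] A cov bnd.
  suff -> : A = set0 by rewrite cards0 mul0r.
  by apply/setP => a; rewrite inE; apply/negP => /cov[].
pose A1 := [set a in A | P i a]; pose A2 := A :\: A1.
have -> : A = A1 :|: A2.
  by apply/setP => a; rewrite !inE; case: (a \in A); case: (P i a).
have le2 : #|A2|%:R <= (size l)%:R * K.
  apply: IH => [a|j jl].
    rewrite !inE => /andP[nP aA]; have [j] := cov _ aA.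
    by rewrite inE => /orP[/eqP -> Pa|jl Pa]; [rewrite aA Pa in nP | exists j].
  apply: le_trans (bnd j _); last by rewrite inE jl orbT.
  rewrite ler_nat; apply: subset_leq_card; apply/subsetP => a.
  by rewrite !inE => /andP[/andP[_ ->] ->].
have le1 := bnd i (mem_head _ _).
apply: (@le_trans _ _ (#|A1|%:R + #|A2|%:R)).
  by rewrite -natrD ler_nat cardsU leq_subr.
by rewrite /= -addn1 natrD mulrDl mul1r addrC lerD.
Qed.

Lemma packing (D : R) n (s r : R) (p : U) (A : {set S}) :
  doubling U D -> (forall a, a \in A -> mdist p (val a) <= r) ->
  (forall a b, a \in A -> b \in A -> a != b -> s < fdist a b) ->
  r + r <= s * 2 ^+ n -> #|A|%:R <= (2 `^ D) ^+ n.
Proof.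
move=> dD; elim: n r p A => [|n IH] r p A Ar As le.
  rewrite expr0 (_ : 1 = 1%:R) // ler_nat; apply/card_le1_eqP => a b aA bA.
  apply/eqP; apply: contraT; rewrite eq_sym => ab; have := As a b aA bA ab; rewrite ltNge => /negP[].
  rewrite expr0 mulr1 in le; apply: le_trans le.
  apply: le_trans (metric_triangle _ p _) _; apply: lerD; last exact: Ar.
  by rewrite metric_sym; exact: Ar.
have [Y [cY sub]] := dD p r.
have := @card_cover S U (enum_fset Y) A (fun y a => mdist y (val a) <= r / 2) ((2 `^ D) ^+ n).
move=> H; apply: (le_trans (H _ _)).
- move=> a aA; have := sub (val a) (Ar _ aA).
  by case=> y /= yY ya; exists y.
- move=> y _; apply: (IH (r / 2) y) => [a|a b|].
  + by rewrite inE => /andP[].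
  + by rewrite !inE => /andP[aA _] /andP[bA _]; exact: As.
  rewrite -splitr; rewrite exprS mulrCA in le.
  have : 0 <= 2 * (s * 2 ^+ n) - (r + r) by lra.
  lra.
by rewrite exprS; apply: ler_wpM2r cY; rewrite exprn_ge0 // powR_ge0.
Qed.

(** If [D < 1], fewer than two balls are allowed, so every ball lies in a single ball of half its
    radius. Two halvings of the ball about [p] through [q] put both points within a quarter of their
    distance from a common center. *)
Lemma doubling_ge1 (D : R) (p q : U) : doubling U D -> p != q -> 1 <= D.
Proof.
move=> dD pq; rewrite leNgt; apply/negP => D1.
have lt2 : 2 `^ D < (2 : R).
  apply: le_lt_trans (_ : 2 `^ (Num.max D 0) < 2).
    by apply: ler_powR; [lra | rewrite le_max lexx].
  have m1 : Num.max D 0 < 1 by rewrite gt_max D1 ltr01.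
  have m0 : 0 <= Num.max D 0 by rewrite le_max lexx orbT.
  rewrite -[X in _ < X](@lnK R) ?posrE // -[X in X < _](@lnK R) ?posrE ?powR_gt0 //.
  rewrite ltr_expR ln_powR -[X in _ < X]mul1r ltr_pM2r // ln_gt0 //; lra.
have one (x : U) (r : R) : 0 <= r -> exists y : U, forall z : U, mdist x z <= r -> mdist y z <= r / 2.
  move=> r0; have [Y [cY sub]] := dD x r.
  have : (size (enum_fset Y) <= 1)%N.
    by rewrite -ltnS -(ltr_nat R); apply: le_lt_trans cY lt2.
  have xx : cball x r x by rewrite /cball /= mdistxx.
  have [y yY _] := sub x xx.
  have {}yY : y \in enum_fset Y by [].
  case E : (enum_fset Y) yY => [//|y' [|//]] yY _; exists y' => z /sub[w wY wz].
  have : w \in enum_fset Y by [].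
  by rewrite E inE => /eqP <-.
have d0 : 0 < mdist p q by rewrite mdist_gt0.
have [y1 H1] := one p _ (ltW d0).
have [|y2 H2] := one y1 (mdist p q / 2); first by rewrite divr_ge0 // ltW.
have Hp := H2 p (H1 p _); have Hq := H2 q (H1 q (lexx _)).
have {}Hp : mdist y2 p <= mdist p q / 2 / 2 by apply: Hp; rewrite mdistxx ltW.
have := metric_triangle p y2 q; rewrite (metric_sym p y2); lra.
Qed.

End Packing.

(** * Cover radius and aspect ratio *)

Section Radius.
Variables (R : realType) (U : metricType R) (S : {fset U}) (M : matroid S).

Definition covers (C : {set S}) (r : R) := forall p, exists2 c, c \in C & fdist p c <= r.

Lemma cover_radius_le (C : {set S}) (r : R) : covers C r -> (cover_radius C <= r%:E)%E.
Proof.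
move=> cov; apply: bigmax_le => [|p _]; first exact: leNye.
have [c cC le] := cov p.
by apply: (bigmin_inf c) => //; rewrite lee_fin.
Qed.

Lemma cover_radius_covers (C : {set S}) (r : R) :
  (cover_radius C <= r%:E)%E -> covers C r.
Proof.
move=> /bigmax_leP[_ le] p; have := le p isT.
have [->|[c0 c0C]] := set_0Vmem C; first by rewrite big_set0.
have [|c cC ->] := @eq_bigmin _ _ _ (+oo%E : \bar R) c0 (mem C) (fun q => (fdist p q)%:E) c0C.
  by move=> i _; exact: leey.
by rewrite lee_fin; exists c.
Qed.

(* An independent set covers within a times the optimum as soon as it does so
   for the radius of every feasible solution; if there is none, the optimum is
   infinite. *)
Lemma approx_intro (p0 : S) (s : {set S}) (a : R) : 0 < a ->
  (forall C rho, C \in indep M -> 0 <= rho -> covers C rho -> covers s (a * rho)) ->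
  (cover_radius s <= a%:E * opt_radius M)%E.
Proof.
move=> a0 H; rewrite /opt_radius.
have [|C Ci ->] := @eq_bigmin _ _ _ (+oo%E : \bar R) set0 (fun C => C \in indep M)
    (fun C => cover_radius C) (indep_set0 M).
  by move=> i _; exact: leey.
case E : (cover_radius C) => [r| |].
- have cov : covers C r by apply: cover_radius_covers; rewrite E.
  have r0 : 0 <= r by have [c _ le] := cov p0; exact: le_trans (fdist_ge0 _ _) le.
  by rewrite -EFinM; apply: cover_radius_le; exact: H r0 cov.
- by rewrite gt0_muley ?lte_fin // leey.
have : (cover_radius C <= (-1)%:E)%E by rewrite E leNye.
move=> /cover_radius_covers/(_ p0)[c _ le].
by have := le_trans (fdist_ge0 p0 c) le; rewrite oppr_ge0 ler10.
Qed.

Lemma max_dist_ge (p q : S) : p != q -> fdist p q <= max_dist S.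
Proof. by move=> pq; apply: (bigmax_sup (p, q)). Qed.

Lemma min_dist_le (p q : S) : p != q -> min_dist S <= fdist p q.
Proof. by move=> pq; apply: (bigmin_inf (p, q)). Qed.

Lemma max_dist_gt0 (p q : S) : p != q -> 0 < max_dist S.
Proof. by move=> pq; apply: lt_le_trans (max_dist_ge pq); exact: fdist_gt0. Qed.

Lemma min_dist_gt0 (p q : S) : p != q -> 0 < min_dist S.
Proof.
move=> pq; apply/bigmin_gtP; split; first exact: max_dist_gt0 pq.
by move=> [a b] /= ab; exact: fdist_gt0.
Qed.

Lemma ln_aspect (p q : S) : p != q ->
  ln (aspect_ratio S) = ln (max_dist S) - ln (min_dist S).
Proof.
by move=> pq; rewrite ln_div // posrE; [exact: max_dist_gt0 pq | exact: min_dist_gt0 pq].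
Qed.

Lemma ln_aspect_ge0 : 0 <= ln (aspect_ratio S).
Proof.
have [[p [q pq]]|no] := pselect (exists p q : S, p != q).
  rewrite (ln_aspect pq) subr_ge0 ler_ln ?posrE;
    [|exact: min_dist_gt0 pq | exact: max_dist_gt0 pq].
  exact: le_trans (min_dist_le pq) (max_dist_ge pq).
rewrite /aspect_ratio /max_dist big_pred0 ?mul0r ?ln0 // => -[a b] /=.
by apply/negbTE/negP => ab; apply: no; exists a, b.
Qed.

(** Taking logarithms in base 2, [b] is at least the logarithm of the minimum distance and at most 2
    more than that of the maximum. Counting both ends gives 3 beyond the difference of the floors,
    and rounding gives the fourth. *)
Lemma branch_range (p0 q0 : S) : p0 != q0 -> exists lo hi : int,
  (forall (p q : S) (b : int), p != q -> (2 : R) ^ (b - 2) < fdist p q ->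
     fdist p q <= 2 ^ b -> lo <= b <= hi) /\
  (0 <= hi - lo + 1 /\ (hi - lo + 1)%:~R <= ln (aspect_ratio S) / ln 2 + 4).
Proof.
move=> pq0; have mx := max_dist_gt0 pq0; have mn := min_dist_gt0 pq0.
have l2 : 0 < ln (2 : R) by apply: ln_gt0; lra.
have lnX (z : int) : ln ((2 : R) ^ z) = z%:~R * ln 2.
  by rewrite -powR_intmul ?ler0n // ln_powR.
have pX (z : int) : 0 < (2 : R) ^ z by rewrite exprz_gt0.
exists (Num.floor (ln (min_dist S) / ln 2)), (Num.floor (ln (max_dist S) / ln 2) + 2).
set x := ln (min_dist S) / ln 2; set y := ln (max_dist S) / ln 2.
have xy : x <= y.
  rewrite ler_pM2r ?invr_gt0 // ler_ln ?posrE //.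
  exact: le_trans (min_dist_le pq0) (max_dist_ge pq0).
split=> [p q b pq lt le|].
  have dp := fdist_gt0 pq; apply/andP; split.
    rewrite -ltzD1 floor_lt_int intrD /=.
    apply: (@le_lt_trans _ _ b%:~R); last by rewrite ltrDl ltr01.
    rewrite ler_pdivrMr // -lnX ler_ln ?posrE //.
    exact: le_trans (min_dist_le pq) le.
  rewrite -lerBlDr floor_ge_int ler_pdivlMr // -lnX ler_ln ?posrE //.
  exact: le_trans (ltW lt) (max_dist_ge pq).
have /andP[f1 f2] := floor_itv x; have /andP[g1 g2] := floor_itv y.
have fg : Num.floor x <= Num.floor y by apply: le_floor.
split; first by clear -fg; lia.
rewrite (ln_aspect pq0) mulrBl -/x -/y.
move: f1 f2 g1 g2; rewrite !intrD !intrN /=; clear; lra.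
Qed.

End Radius.

(** * Polynomially bounded costs *)

Section PolynomialBounds.
Local Open Scope nat_scope.

(** Coefficient and degree stay existential: closure under sums, products and folds is enough, and
    no exponent is computed. *)
Definition polyb (f : nat -> nat) := exists C e, forall n, f n <= C * n.+1 ^ e.

Lemma polyb_const c : polyb (fun=> c).
Proof. by exists c, 0 => n; rewrite expn0 muln1. Qed.

Lemma polyb_id : polyb id.
Proof. by exists 1, 1 => n; rewrite expn1 mul1n. Qed.

Lemma polyb_add f g : polyb f -> polyb g -> polyb (fun n => f n + g n).
Proof.
move=> [C [e H]] [C' [e' H']]; exists (C + C'), (e + e') => n; rewrite mulnDl.
apply: leq_add; [apply: leq_trans (H n) _ | apply: leq_trans (H' n) _];
  by rewrite leq_mul2l leq_pexp2l ?orbT // (leq_addl, leq_addr).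
Qed.

Lemma polyb_mul f g : polyb f -> polyb g -> polyb (fun n => f n * g n).
Proof.
move=> [C [e H]] [C' [e' H']]; exists (C * C'), (e + e') => n.
by rewrite expnD mulnACA leq_mul.
Qed.

Lemma polyb_fold c : polyb c -> polyb (fun n => fold_cost n (c n)).
Proof.
move=> pc; apply: polyb_add; first exact: polyb_const.
by apply: polyb_mul; [exact: polyb_id | apply: polyb_add pc _; exact: polyb_const].
Qed.

Definition solve_c n := 60 + fold_cost n 60 + all_mis_c n + best_c n + fold_cost n 60.

Ltac polyb := repeat first
  [ exact: polyb_const | exact: polyb_id | apply: polyb_fold
  | apply: polyb_add | apply: polyb_mul ].

Lemma polyb_addable : polyb addable_c. Proof. by rewrite /addable_c; polyb. Qed.

Lemma polyb_apply : polyb (fun n => apply_c n n).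
Proof.
by rewrite /apply_c /last_addable_c; polyb; exact: polyb_addable.
Qed.

Lemma polyb_reach : polyb reach_c.
Proof. by rewrite /reach_c /reach_step_c /reach_from_c /swaps_c; polyb. Qed.

Lemma polyb_find_trail : polyb find_trail_c.
Proof. by rewrite /find_trail_c /finish_c; polyb; exact: polyb_addable. Qed.

Lemma polyb_augment : polyb augment_c.
Proof.
rewrite /augment_c; apply: polyb_fold; apply: polyb_add polyb_apply.
apply: polyb_add polyb_reach; apply: polyb_add polyb_find_trail; exact: polyb_const.
Qed.

Lemma polyb_solve : polyb solve_c.
Proof.
rewrite /solve_c /best_c /best_for_c /far_c /all_mis_c; polyb; exact: polyb_augment.
Qed.

Lemma polyb_down : polyb down_c. Proof. by rewrite /down_c; polyb. Qed.

End PolynomialBounds.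

(** * The coreset of maximal independent sets *)

Section Coreset.
Variables (R : realType) (X : finType) (d : X -> X -> R) (M : matroid X).
Hypothesis d_refl : forall p, d p p = 0.
Hypothesis d_ge0 : forall p q, 0 <= d p q.
Hypothesis d_sym : forall p q, d p q = d q p.
Hypothesis d_tri : forall q p s, d p s <= d p q + d q s.
Variables (ns : seq (etree X)) (delta : R).
Hypothesis ns_total : forall q, exists2 u, List.In u ns & q \in subtree_points u.
Hypothesis ns_aug : forall u, List.In u ns -> augmented M u.
Hypothesis ns_cov : forall u q, List.In u ns -> q \in subtree_points u ->
  d (et_point u) q <= delta.

Let Q := flatten [seq et_mis u | u <- ns].
Let pts := [seq et_point u | u <- ns].

Lemma delta_ge0 (q : X) : 0 <= delta.
Proof. by have [u un qu] := ns_total q; exact: le_trans (d_ge0 _ _) (ns_cov un qu). Qed.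

(* Points outside the coreset are exchanged one by one for coreset points of
   the same subtree. *)
Lemma coreset C : C \in indep M -> exists C' : {set X},
  [/\ C' \in indep M, {subset C' <= Q} &
      forall c, c \in C -> exists2 c', c' \in C' & d c c' <= delta + delta].
Proof.
move=> Ci.
(* The invariant says that a point of [C] is either still its own substitute or has one in the
   coreset. Coreset points are never exchanged again, so the error [delta + delta] does not
   accumulate. *)
suff H n (C' : {set X}) : C' \in indep M -> (#|[set c in C' | c \notin Q]| <= n)%N ->
    (forall c, c \in C -> exists c', [/\ c' \in C', d c c' <= delta + delta &
       (c' \in Q) || (c' == c)]) ->
    exists C' : {set X}, [/\ C' \in indep M, {subset C' <= Q} &
      forall c, c \in C -> exists2 c', c' \in C' & d c c' <= delta + delta].
  apply: (H #|[set c in C | c \notin Q]| C) => // c cC; exists c.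
  by rewrite d_refl addr_ge0 ?(delta_ge0 c) // eqxx orbT.
elim: n C' => [|n IH] C' C'i le near.
  exists C'; split=> // [c cC'|c /near[c' [? ? _]]]; last by exists c'.
  apply: contraT => cQ; move: le; rewrite leqn0 cards_eq0 => /eqP/setP/(_ c).
  by rewrite !inE cC' cQ.
have [E|[x]] := set_0Vmem [set c in C' | c \notin Q].
  by apply: (IH C') => //; rewrite E cards0.
rewrite inE => /andP[xC' xQ]; have [u un xu] := ns_total x.
have [_ _ mis _] := augmented_inv (ns_aug un).
have [||q qN [qi qC']] := mis_replace mis _ xC' C'i; first by rewrite inE.
  rewrite inE; apply: contra xQ => xm; apply/mem_flatten_map; by exists u.
rewrite inE in qN.
have qQ : q \in Q by apply/mem_flatten_map; exists u.
have qu : q \in subtree_points u.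
  have [_ /subsetP/(_ q)] := mis_sub mis; rewrite !inE; exact.
apply: (IH (q |: (C' :\ x))) => //.
  rewrite -ltnS; apply: leq_trans le; rewrite (cardsD1 x [set c in C' | c \notin Q]) inE xC' xQ.
  rewrite add1n ltnS; apply: subset_leq_card; apply/subsetP => y; rewrite !inE.
  case/andP => /orP[/eqP ->|/andP[-> ->] ->//]; by rewrite qQ.
move=> c /near[c' [c'C' dc']] c'Q.
have [Ex|ne] := eqVneq c' x; last first.
  by exists c'; split=> //; rewrite !inE ne c'C' orbT.
move: c'Q; rewrite Ex (negbTE xQ) /= => /eqP <-.
exists q; split; [by rewrite !inE eqxx| |by rewrite qQ].
apply: le_trans (d_tri (et_point u) _ _) _; apply: lerD; last exact: ns_cov.
by rewrite d_sym; exact: ns_cov.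
Qed.

Lemma solve_approx (C : {set X}) (rho : R) (p0 : X) :
  C \in indep M -> (forall p, exists2 c, c \in C & d p c <= rho) ->
  exists r J, [/\ best d M pts Q pts = Some (r, J), uniq (elems J), ind M (elems J),
    (size J <= size pts)%N &
    forall q, exists2 x, x \in elems J & d q x <= 3 * rho + 7 * delta].
Proof.
move=> Ci cov; have [C' [C'i C'Q near]] := coreset Ci.
have [u0 u0n _] := ns_total p0.
have p1 : et_point u0 \in pts by apply/map_in; exists u0.
have [|r [J [Eb uJ iJ sJ covJ]]] :=
    best_approx d_refl d_ge0 d_sym d_tri p1 C'i C'Q (rho := rho + (delta + delta)).
  move=> p _; have [c cC dpc] := cov p; have [c' c'C' dcc'] := near c cC.
  by exists c' => //; apply: le_trans (d_tri c _ _) _; apply: lerD.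
exists r, J; split=> // q; have [u un qu] := ns_total q.
have [|x xJ dx] := covJ (et_point u); first by apply/map_in; exists u.
exists x => //; have dq : d q (et_point u) <= delta by rewrite d_sym; exact: ns_cov.
have := d_tri (et_point u) q x; move: dx dq; lra.
Qed.

End Coreset.

Lemma solve_evb (R : realType) (X : finType) (d : X -> X -> R) (M : matroid X)
    (d_refl : forall p, d p p = 0) (d_ge0 : forall p q, 0 <= d p q)
    (d_sym : forall p q, d p q = d q p)
    (d_tri : forall q p s, d p s <= d p q + d q s)
    (n : nat) (env : seq (value R X)) (ns : seq (etree X)) (r : R) (J : seq (X * X)) :
  (size ns + size ns + 2 <= n)%N ->
  (size (flatten [seq et_mis u | u <- ns]) <= n)%N ->
  (forall u, List.In u ns -> (size (et_mis u) <= n)%N) ->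
  best d M [seq et_point u | u <- ns] (flatten [seq et_mis u | u <- ns])
    [seq et_point u | u <- ns] = Some (r, J) ->
  (size J <= n)%N ->
  evb d M functions_text (enc_trees R ns :: env) solve_text (enc_points (elems J)) (solve_c n).
Proof.
move=> sn sQ sm Eb sJ; rewrite /solve_text.
have sn1 : (size ns <= n)%N by apply: leq_trans sn; rewrite -addnA leq_addr.
eapply evb_le.
  eapply evb_let; first by eapply evb_call; [ev | exact: (@points_fnb R X d M n)].
  eapply evb_let; first by eapply evb_call; [ev | exact: (@all_mis_fnb R X d M n)].
  eapply (evb_case_option (f := fun rJ : R * _ => VReal rJ.1)
    (g := fun rJ => @enc_pairs R X rJ.2) (o := Some (r, J)) (B1 := 0%N)).
  - rewrite -Eb; eapply evb_call; first by ev.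
    by apply: (@best_fnb R X d M d_refl d_ge0 d_sym d_tri n) => //; rewrite size_map.
  - by [].
  move=> _ [<-]; eapply evb_call; first by ev.
  exact: (@elems_fnb R X d M n).
rewrite /solve_c; bound.
Qed.

Lemma size_all_mis (X : finType) (ns : seq (etree X)) (k : nat) :
  (forall u, List.In u ns -> (size (et_mis u) <= k)%N) ->
  (size (flatten [seq et_mis u | u <- ns]) <= k * size ns)%N.
Proof.
elim: ns => [|u ns IH] H; first by rewrite muln0.
rewrite /= size_cat mulnS leq_add //; first by apply: H; left.
by apply: IH => v vn; apply: H; right.
Qed.

(** * The algorithm *)

Section Main.
Variables (R : realType) (U : metricType R) (D : R) (S : {fset U}) (M : matroid S) (k : nat).
Variables (T : cover_tree (@fdist R U S)) (eps : R).
Hypothesis D_doubling : doubling U D.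
Hypothesis D_ge0 : 0 <= D.
Hypothesis M_rank : is_matroid_rank M k.
Hypothesis eps_gt0 : 0 < eps.

Let z := (64 / eps) `^ D.
Let fr := @front R S (@fdist R U S) M T.

Lemma refine_steps : exists j : nat, [/\ 1 <= eps * 2 ^+ j,
  forall i, (i < j)%N -> eps * 2 ^+ i < 1 & (0 < j)%N -> eps < 1 /\ 2 ^+ j < 2 / eps].
Proof.
have ex : exists j, 1 <= eps * 2 ^+ j.
  have e0 : 0 <= 1 / eps by rewrite divr_ge0 // ltW.
  exists (Num.bound (1 / eps)); rewrite mulrC -ler_pdivrMr //.
  apply: le_trans (ltW (archi_boundP e0)) _.
  by rewrite -natrX ler_nat ltnW // ltn_expl.
have [j ge min] := ex_minnP ex; exists j.
have lt i : (i < j)%N -> eps * 2 ^+ i < 1.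
  by move=> ij; rewrite ltNge; apply/negP => /min; rewrite leqNgt ij.
split=> // j0; split; first by have := lt 0 j0; rewrite expr0 mulr1.
rewrite ltr_pdivlMr // mulrC -(prednK j0) exprS mulrCA.
have := lt j.-1; rewrite prednK // leqnn => /(_ isT) h.
by rewrite -[X in _ < X]mulr1 ltr_pM2l.
Qed.

(** Each point of level [m - j] is within [2 ^ (m + 1)] of a frontier point. The diameter
    [2 ^ (m + 2)] exceeds the separation [2 ^ (m - j)] by the factor [2 ^ (j + 2)], hence [j.+2]
    halvings. *)
Lemma level_card m (j : nat) ns : fr m ns ->
  #|ct_level T (m - j%:Z)|%:R <= (size ns)%:R * (2 `^ D) ^+ j.+2 :> R.
Proof.
move=> F; rewrite -(size_map (@et_point S) ns).
apply: (@card_cover R S S _ _ (fun p a => fdist p a <= 2 ^ (m + 1))).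
  move=> a _; have [v vn av] := front_total a F.
  exists (et_point v); first by apply/map_in; exists v.
  exact: (front_cov (@fdist_refl _ _ S) (@fdist_sym _ _ S) (@fdist_tri _ _ S) F vn av).
move=> p _; apply: (@packing R U S D j.+2 (2 ^ (m - j%:Z)) (2 ^ (m + 1)) (val p)) => //.
- by move=> a; rewrite inE => /andP[].
- move=> a b; rewrite !inE => /andP[aT _] /andP[bT _] ab.
  exact: (ct_separation aT bT).
have -> : (2 : R) ^ (m + 1) + 2 ^ (m + 1) = 2 ^ (m + 2).
  rewrite (_ : m + 2 = m + 1 + 1); last by rewrite -addrA.
  by rewrite [in RHS]exprzDr ?unitfE ?pnatr_eq0 // expr1z mulr_natr mulr2n.
rewrite -[_ ^+ _]/((2 : R) ^ (j.+2 : int)) -exprzDr ?unitfE ?pnatr_eq0 //.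
by rewrite (_ : m - j%:Z + j.+2 = m + 2) //; clear; lia.
Qed.

(** [2 ^+ j.+2] is below [8 / eps], so the base 64 leaves room to spare. *)
Lemma doubling_power (j : nat) : 2 ^+ j < 2 / eps -> (2 `^ D) ^+ j.+2 <= z.
Proof.
move=> lt; rewrite -powR_mulrn ?powR_ge0 // -powRrM mulrC powRrM powR_mulrn //.
apply: ge0_ler_powR => //; rewrite ?nnegrE ?exprn_ge0 // ?divr_ge0 ?(ltW eps_gt0) //.
have e0 : 0 < eps^-1 by rewrite invr_gt0.
rewrite !exprS; move: lt e0; lra.
Qed.

Lemma optimum_lower m (C : {set S}) rho :
  (k < #|ct_level T (m - 1)|)%N -> C \in indep M -> covers C rho -> 2 ^ (m - 2) <= rho.
Proof.
move=> lt Ci cov.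
have /choice[g gP] : forall p, exists c, c \in C /\ fdist p c <= rho.
  by move=> p; have [c] := cov p; exists c.
have : ~ {in ct_level T (m - 1) &, injective g}.
  move=> inj; have := leq_trans lt (eq_leq (esym (card_in_imset inj))).
  rewrite ltnNge => /negP[]; apply: leq_trans (indep_leq_rank M_rank Ci).
  apply: subset_leq_card; apply/subsetP => _ /imsetP[p _ ->].
  by case: (gP p).
move=> ninj; have [p [q [pT qT Eg pq]]] : exists p q, [/\ p \in ct_level T (m - 1),
    q \in ct_level T (m - 1), g p = g q & p != q].
  apply: contrapT => no; apply: ninj => p q pT qT Eg; apply/eqP.
  by apply: contrapT => /negP pq; apply: no; exists p, q.
have lt2 := ct_separation pT qT pq.
have := fdist_tri (g p) p q; have [_ h1] := gP p; have [_] := gP q.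
rewrite -Eg (fdist_sym q) => h2 h3.
have E : (2 : R) ^ (m - 1) = 2 ^ (m - 2) + 2 ^ (m - 2).
  rewrite (_ : m - 1 = m - 2 + 1); last by clear; lia.
  by rewrite exprzDr ?unitfE ?pnatr_eq0 // expr1z mulr_natr mulr2n.
move: lt2 h1 h2 h3; rewrite E; lra.
Qed.

(** If no chain ends any more, every subtree is a single point, the refinement does nothing and
    [delta] is 0. Otherwise [delta * 2 ^+ j = 8 * 2 ^ (m - 2)], at most [8 * rho] by
    [optimum_lower], and [1 <= eps * 2 ^+ j] trades the power for [eps]. The summand 1 beside [z]
    covers the unrefined frontier, as [z] may be small for large [eps]. *)
Lemma refined_frontier m ns' j :
  (size ns' <= k)%N ->
  (exists2 l', fr l' ns' & forall u, List.In u ns' -> et_bot u = None) \/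
    (fr m ns' /\ (k < #|ct_level T (m - 1)|)%N) ->
  1 <= eps * 2 ^+ j -> ((0 < j)%N -> eps < 1 /\ 2 ^+ j < 2 / eps) ->
  let ns := refined j m ns' in
  [/\ exists l, fr l ns,
      forall i, (i <= j)%N -> (size (refined i m ns') <= size ns)%N,
      (size ns)%:R <= k%:R * (1 + z) &
      exists delta, (forall u q, List.In u ns -> q \in subtree_points u ->
          fdist (et_point u) q <= delta) /\
        (forall C rho, C \in indep M -> 0 <= rho -> covers C rho ->
          delta <= 8 * eps * rho)].
Proof.
move=> szk [[l' F none]|[F ltk]] ge jP ns.
  have E i : refined i m ns' = ns' by exact: refined_id.
  rewrite /ns E; split.
  - by exists l'.
  - by move=> i _; rewrite E.
  - apply: (@le_trans _ _ k%:R); first by rewrite ler_nat.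
    by rewrite -[X in X <= _]mulr1 ler_wpM2l // lerDl powR_ge0.
  exists 0; split=> [u q un|C rho _ r0 _].
    case: F => _ _ _ /(_ _ un)[ex _ _ _].
    have [_ _ /(_ (none _ un))[_ Ec] _] := explicit_inv ex.
    by rewrite subtree_pointsE Ec inE => /eqP ->; rewrite fdist_refl.
  by rewrite mulr_ge0 // mulr_ge0 // ltW.
have Fi i : fr (m - i%:Z) (refined i m ns') by exact: front_refined.
split.
- by exists (m - j%:Z); exact: Fi.
- move=> i ij; rewrite !(front_size (Fi _)); apply: subset_leq_card; apply: level_le.
  by move: ij; clear; lia.
- case: (posnP j) => [j0|j0].
    rewrite /ns j0 /=; apply: (@le_trans _ _ k%:R); first by rewrite ler_nat.
    by rewrite -[X in X <= _]mulr1 ler_wpM2l // lerDl powR_ge0.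
  rewrite (front_size (Fi j)); apply: le_trans (level_card j F) _.
  have [_ lt] := jP j0.
  apply: ler_pM; [exact: ler0n|by rewrite exprn_ge0 ?powR_ge0|by rewrite ler_nat|].
  by apply: le_trans (doubling_power lt) _; rewrite lerDr.
exists (2 ^ (m - j%:Z + 1)); split=> [u q un qu|C rho Ci r0 cov].
  exact: (front_cov (@fdist_refl _ _ S) (@fdist_sym _ _ S) (@fdist_tri _ _ S) (Fi j) un qu).
have low := optimum_lower ltk Ci cov.
have E : (2 : R) ^ (m - j%:Z + 1) * 2 ^+ j = 8 * 2 ^ (m - 2).
  rewrite -[_ ^+ j]/((2 : R) ^ (j : int)) -exprzDr ?unitfE ?pnatr_eq0 //.
  rewrite (_ : m - j%:Z + 1 + j = 3%:Z + (m - 2)); last by clear; lia.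
  rewrite exprzDr ?unitfE ?pnatr_eq0 //; congr (_ * _).
  by rewrite -exprnP !exprS expr0; lra.
have p0 : 0 < (2 : R) ^+ j by rewrite exprn_gt0.
rewrite -(ler_pM2r p0) E -!mulrA ler_pM2l //.
apply: le_trans low _; rewrite mulrCA -[X in X <= _]mulr1.
by apply: ler_wpM2l.
Qed.

End Main.

(** The time is kept as a sum in [n], [j] and [N], separate from the polynomial, which has to be
    fixed before the instance. The constant alternative is for a single point or rank 0. *)
Lemma center_run (R : realType) (U : metricType R) (D : R) (S : {fset U}) (M : matroid S)
    (k : nat) (T : cover_tree (@fdist R U S)) (u : etree S) (eps : R) :
  0 <= D -> doubling U D -> is_matroid_rank M k -> explicit_representation T u ->
  augmented M u -> 0 < eps ->
  let z := (64 / eps) `^ D in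
  exists (s : seq S) (n j N t : nat),
    [/\ evb (@fdist R U S) M functions_text [:: enc_etree u; VReal eps] main_text
          (enc_points s) t,
        uniq s, [set p in s] \in indep M,
        (cover_radius [set p in s] <= (3 + 56 * eps)%:E * opt_radius M)%E &
        (t <= 100)%N \/
        [/\ (0 < k)%N, t = (100 + 500 * k.+1 * N.+1 + refine_c n j + solve_c n)%N,
            n.+1%:R <= (k%:R + 3) ^+ 2 * (1 + z), j%:R <= z &
            N%:R <= ln (aspect_ratio S) / ln 2 + 4]].
Proof.
move=> D0 dD rk ex au eps0 z.
have rootF := root_front ex au; have [Ew um mis _] := augmented_inv au.
have all_points : [set q in subtree_points u] = [set: S].
  apply/setP => q; rewrite !inE; have [v] := front_total q rootF.
  by case=> [->|[]].
rewrite all_points in Ew mis.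
have [mi _] := mis_sub mis.
have sk : size (et_mis u) = k.
  rewrite -(card_uniqP um) -cardsE; apply: rk.
  apply/maxsetP; split=> // B Bi sub; apply: (maxsetsup mis) => //=.
  by rewrite [_ \in _]Bi subsetT.
have a0 : 0 < 3 + 56 * eps by lra.
have p0 : S := ct_root T.
have no_opt C rho : k = 0%N -> C \in indep M -> covers C rho -> False.
  move=> k0 Ci cov; have [c cC _] := cov p0.
  have := indep_leq_rank rk Ci; rewrite k0 leqn0 cards_eq0 => /eqP C0.
  by rewrite C0 inE in cC.
have [w1|w1] := leqP (et_weight u) 1.
  exists (et_mis u), 0%N, 0%N, 0%N, 100%N; split=> //; last by left.
    rewrite /main_text enc_etreeE; eapply evb_le.
      eapply (evb_if (B2 := 0%N)); first by ev.
        by move=> _; evr.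
      by rewrite lez_nat w1.
    bound.
  apply: (approx_intro p0 a0) => C rho Ci rho0 cov p.
  have [k0|] := posnP k; first by case: (no_opt C rho k0).
  rewrite -sk; case: (et_mis u) um mi => [//|x s'] _ _ _; exists x.
    by rewrite !inE eqxx.
  have -> : x = p.
    have /card_le1_eqP H : (#|[set: S]| <= 1)%N by rewrite -Ew.
    exact: (H p x (in_setT _) (in_setT _)).
  by rewrite fdist_refl mulr_ge0 // ltW.
have [k0|k0] := posnP k.
  exists [::], 0%N, 0%N, 0%N, 100%N; split=> //; last by left.
  - have m0 : et_mis u = [::] by apply: size0nil; rewrite sk.
    rewrite /main_text enc_etreeE m0; eapply evb_le.
      eapply (evb_if (B1 := 0%N)); first by ev.
        by rewrite lez_nat leqNgt w1.
      move=> _; eapply (evb_case_list (f := VPoint) (s := [::]) (B2 := 0%N)); first by ev.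
        by move=> _; evr.
      by [].
    bound.
  - suff -> : [set p in [::]] = set0 :> {set S} by exact: indep_set0.
    by apply/setP => x; rewrite !inE.
  by apply: (approx_intro p0 a0) => C rho Ci _ cov; case: (no_opt C rho k0).
have [p [q [_ _ pq]]] : exists p q : S, [/\ p \in [set: S], q \in [set: S] & p != q].
  by apply/card_gt1P; rewrite -Ew.
have [lo [hi [range [hl0 hl1]]]] := branch_range pq.
pose N := absz (hi - lo + 1).
have EN : N%:Z = hi - lo + 1 by rewrite /N gez0_abs.
have hN (b : int) : b <= ct_top T -> b <= hi -> b < lo + N%:Z.
  by rewrite EN; clear; lia.
have s1 : (size [:: u] <= size (et_mis u))%N by rewrite sk.
have [m [ns' [ev1 le1 H1]]] := coarse_fnb (@fdist_sym _ _ S) range hN rootF s1.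
rewrite sk in le1 H1.
have [j [jge jlt jP]] := refine_steps eps0.
have := refined_frontier dD D0 rk eps0 le1 H1 jge jP.
set ns := refined j m ns' => -[[l F] szi szn [delta [dcov dopt]]].
have tot q' := front_total q' F.
have aug v : List.In v ns -> augmented M v by case: F => _ _ _ H /H[].
have szm v : List.In v ns -> (size (et_mis v) <= k)%N.
  move=> vn; have [_ uv mv _] := augmented_inv (aug v vn).
  rewrite -(card_uniqP uv) -cardsE; apply: indep_leq_rank rk _.
  by case: (mis_sub mv).
have SA := solve_approx (@fdist_refl _ _ S) (@fdist_ge0 _ _ S) (@fdist_sym _ _ S)
  (@fdist_tri _ _ S) tot aug dcov.
have [x xm] : exists x, x \in et_mis u.
  by case: (et_mis u) sk => [sk|x s' _]; [rewrite -sk in k0 | exists x; rewrite inE eqxx].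
have xi : [set x] \in indep M by apply: indep_subset mi; rewrite sub1set inE.
(* An arbitrary independent singleton, with the sum of all distances to it as a crude radius, shows
   that the search returns some result even before an optimum is considered. *)
have [|r [J [Eb uJ iJ sJ _]]] := SA [set x] (\sum_y fdist y x) p0 xi.
  move=> y; exists x; first by rewrite inE.
  by rewrite (bigD1 y) //= lerDl sumr_ge0 // => *; exact: fdist_ge0.
(* A common bound for all lists: [k * size ns] for the coreset, [2 * size ns + 2] for the pivots in
   [augment_fnb]. *)
pose n := ((k + 2) * size ns + 2)%N.
have nn : (size ns + size ns + 2 <= n)%N by rewrite /n mulnDl mul2n addnn leq_add2r leq_addl.
have n1 : (size ns <= n)%N by apply: leq_trans nn; rewrite -addnA leq_addr.
have ns0 : (0 < size ns)%N.
  by have [v] := tot p0; case: (ns).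
have kn : (k <= n)%N.
  rewrite /n mulnDl -addnA; apply: leq_trans (leq_addr _ _).
  by rewrite -[X in (X <= _)%N]muln1 leq_mul2l ns0 orbT.
exists (elems J), n, j, N, (100 + 500 * k.+1 * N.+1 + refine_c n j + solve_c n)%N; split=> //.
- have szm' v : List.In v ns -> (size (et_mis v) <= n)%N.
    by move=> vn; exact: leq_trans (szm v vn) kn.
  have sQ : (size (flatten [seq et_mis v | v <- ns]) <= n)%N.
    apply: leq_trans (size_all_mis szm) _.
    by rewrite /n mulnDl -addnA leq_addr.
  have sJ' : (size J <= n)%N by rewrite size_map in sJ; exact: leq_trans sJ n1.
  have ref : fnb (@fdist R U S) M functions_text refine_f
      (VPair (VReal eps) (VPair (VInt m) (enc_trees R ns'))) (enc_trees R ns) (refine_c n j).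
    by apply: refine_fnb => // i ij; apply: leq_trans (szi i ij) n1.
  rewrite /main_text enc_etreeE; eapply evb_le.
    eapply (evb_if (B1 := 0%N)); first by ev.
      by rewrite lez_nat leqNgt w1.
    move=> _; eapply (evb_case_list (f := VPoint) (s := et_mis u) (B1 := 0%N)); first by ev.
      by move=> m0; rewrite m0 in xm.
    move=> y s' Em; eapply evb_let.
      eapply evb_call; last exact: ref.
      eapply evb_op2; [by ev| |reflexivity].
      eapply evb_call; last exact: ev1.
      eapply evb_op2; [by ev| |reflexivity].
      eapply evb_eq; first by ev.
      by rewrite -enc_etreeE.
    eapply solve_evb; [exact: fdist_refl|exact: fdist_ge0|exact: fdist_sym|
      exact: fdist_tri|exact: nn|exact: sQ|exact: szm'|exact: Eb|exact: sJ'].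
  rewrite sk; move: (500 * k.+1 * N.+1)%N (refine_c n j) (solve_c n); clear; lia.
- apply: (approx_intro p0 a0) => C rho Ci rho0 cov y.
  have [r' [J' [Eb' _ _ _ cov']]] := SA C rho p0 Ci cov.
  move: Eb'; rewrite Eb => -[_ EJ]; have [x' x'J dx] := cov' y.
  exists x'; first by rewrite inE EJ.
  apply: le_trans dx _; have := dopt C rho Ci rho0 cov; lra.
right; split=> //.
- have k0' : 0 <= k%:R :> R by rewrite ler0n.
  have z0 : 0 <= z by exact: powR_ge0.
  rewrite /n -addn1 !natrD natrM natrD.
  have : (k%:R + 2) * (size ns)%:R <= (k%:R + 2) * (k%:R * (1 + z)) :> R.
    by apply: ler_wpM2l => //; lra.
  have : 0 <= k%:R * z by exact: mulr_ge0.
  by nra.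
(* For positive [j] the chain is [j <= 2 ^+ j < 2 / eps <= 64 / eps <= z]; the last link needs
   [1 <= D], obtained from the two distinct points. *)
- have [j0|j0] := posnP j; first by rewrite j0 powR_ge0.
  have [e1 lt] := jP j0.
  have pq' : val p != val q by apply: contra pq => /eqP/val_inj ->.
  have D1 := doubling_ge1 dD pq'.
  have ie : 1 < eps^-1 by rewrite invf_gt1.
  apply: (@le_trans _ _ (64 / eps)); last by apply: le1r_powR => //; lra.
  apply: (@le_trans _ _ (2 ^+ j)); last by lra.
  by rewrite -natrX ler_nat ltnW // ltn_expl.
by move: hl1; rewrite -EN.
Qed.

(** * Adding up the running time *)

Section Totals.
Variable R : realFieldType.
Implicit Types (W L K N : R).

Lemma cost_total W L c1 c2 q b1 b2 b3 :
  1 <= W -> 0 <= L -> 0 <= c1 -> 0 <= c2 -> 0 <= q ->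
  b1 <= c1 * W -> b2 <= (80 + c2) * W -> b3 <= q * L + 8000 * W ->
  100 + b3 + b2 + b1 <= (10000 + c1 + c2 + q) * (W + L).
Proof.
move=> W1 L0 c10 c20 q0.
have h1 : 0 <= c1 * L by exact: mulr_ge0.
have h2 : 0 <= c2 * L by exact: mulr_ge0.
have h3 : 0 <= q * W by apply: mulr_ge0 => //; exact: le_trans W1.
move: W1 L0 h1 h2 h3; lra.
Qed.

Lemma coarse_total K N l i W :
  1 <= K -> 0 <= N -> N <= l * i + 4 -> K <= W ->
  500 * (K + 1) * (N + 1) <= 1000 * i * (K * l) + 8000 * W.
Proof.
move=> K1 N0 Nl KW.
have h : (K + 1) * (N + 1) <= (2 * K) * (l * i + 5) by apply: ler_pM; lra.
move: h KW K1; lra.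
Qed.

Lemma refine_total (j c v : R) c2 e :
  0 <= j -> j <= v -> 0 <= c -> 0 <= c2 -> 1 <= v -> c <= c2 * v ^+ e ->
  20 + j * (60 + c) <= (80 + c2) * v ^+ e.+1.
Proof.
move=> j0 jv c0 c20 v1 cle.
have w1 : 1 <= v ^+ e by exact: exprn_ege1.
have h : j * (60 + c) <= v * ((60 + c2) * v ^+ e).
  by apply: ler_pM => //; move: cle w1; lra.
have w2 : 1 <= v ^+ e.+1 by exact: exprn_ege1.
rewrite mulrCA -exprS in h; move: h w2; lra.
Qed.

End Totals.

Theorem theorem5 (R : realType) :
  exists (alg : program) (c A : R) (P : {poly {poly R}}),
  forall (U : metricType R) (D : R) (S : {fset U}) (M : matroid S) (k : nat)
         (T : cover_tree (@fdist R U S)) (u : etree S) (eps : R),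
    is_doubling_dimension U D ->
    is_matroid_rank M k ->
    explicit_representation T u ->
    augmented M u ->
    0 < eps ->
    exists (s : seq S) (t : nat),
      [/\ runs (@fdist R U S) M alg [:: enc_etree u; VReal eps] (enc_points s) t,
          uniq s,
          [set p in s] \in indep M,
          (cover_radius [set p in s] <= (3 + c * eps)%:E * opt_radius M)%E
        & t%:R <= A * (P.[k%:R, (64 / eps) `^ D]
                       + k%:R * ln (aspect_ratio S))].
Proof.
have [C1 [e1 H1]] := polyb_solve; have [C2 [e2 H2]] := polyb_down.
have l2 : 0 < ln (2 : R) by apply: ln_gt0; lra.
(* One exponent for all costs: [e1] for the search, and [e2.+1] for the refinement, whose number of
   rounds contributes one more factor. *)
pose E := (e1 + e2).+1.
(* The outer ['X] stands for the rank and the one under [%:P] for the power of [64 / eps]. The value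
   of [V] dominates [n.+1], the rank and that power, so a single power of it absorbs every
   polynomial cost. *)
pose V : {poly {poly R}} := ('X + 3%:R) ^+ 2 * ('X + 1)%:P.
(* 56 is 7 times 8: the loss is [7 * delta], with [delta] at most [8 * eps * rho]. The factor
   [(ln 2)^-1] converts the count of levels in base 2 to the natural logarithm. *)
exists center_program, 56, (10000 + C1%:R + C2%:R + 1000 * (ln 2)^-1), (V ^+ E).
move=> U D S M k T u eps [D0 dD _] rk ex au eps0.
have [s [n [j [N [t [[t' ev' le'] us iS rad bnd]]]]]] := center_run D0 dD rk ex au eps0.
exists s, t'; split=> //.
set z := (64 / eps) `^ D in bnd *.
have -> : (V ^+ E).[k%:R, z] = ((k%:R + 3) ^+ 2 * (1 + z)) ^+ E.
  by rewrite /V !hornerE; rewrite (addrC z).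
set v := (k%:R + 3) ^+ 2 * (1 + z).
have z0 : 0 <= z by exact: powR_ge0.
have kR : 0 <= k%:R :> R by rewrite ler0n.
have v1 : 1 <= v by rewrite /v; clearbody z; clear -z0 kR; nra.
have kv : k%:R <= v by rewrite /v; clearbody z; clear -z0 kR; nra.
have zv : z <= v by rewrite /v; clearbody z; clear -z0 kR; nra.
have i2 : 0 <= (ln (2 : R))^-1 by rewrite invr_ge0 ltW.
have L0 : 0 <= k%:R * ln (aspect_ratio S) by rewrite mulr_ge0 // ln_aspect_ge0.
have vE e : (e <= E)%N -> v ^+ e <= v ^+ E by move=> le; apply: ler_weXn2l.
have vE1 : 1 <= v ^+ E by exact: exprn_ege1.
have kE : k%:R <= v ^+ E by apply: le_trans kv _; exact: (vE 1%N).
have q0 : 0 <= 1000 * (ln (2 : R))^-1 by rewrite mulr_ge0 ?ler0n.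
apply: (@le_trans _ _ t%:R); first by rewrite ler_nat.
have VE0 : 0 <= v ^+ E by exact: le_trans vE1.
have C0 (C : nat) : 0 <= C%:R * v ^+ E by rewrite mulr_ge0 ?ler0n.
case: bnd => [t100|[kp -> nv jz NL]].
  apply: (@le_trans _ _ (100 + 0 + 0 + 0)).
    by rewrite !addr0 (ler_nat R t 100).
  have h2 : 0 <= (80 + C2%:R) * v ^+ E by rewrite mulr_ge0 // addr_ge0 ?ler0n.
  have h3 : 0 <= 1000 * (ln 2)^-1 * (k%:R * ln (aspect_ratio S)) + 8000 * v ^+ E.
    exact: (addr_ge0 (mulr_ge0 q0 L0) (mulr_ge0 (ler0n _ _) VE0)).
  exact: (cost_total vE1 L0 (ler0n _ _) (ler0n _ _) q0 (C0 _) h2 h3).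
have np e : n.+1%:R ^+ e <= v ^+ e by rewrite lerXn2r // nnegrE ?ler0n // (le_trans ler01).
have h1 : (solve_c n)%:R <= C1%:R * v ^+ E.
  apply: (@le_trans _ _ (C1 * n.+1 ^ e1)%:R); first by rewrite ler_nat.
  rewrite natrM ler_wpM2l ?ler0n // natrX; apply: le_trans (np _) (vE e1 _).
  by rewrite /E ltnW // ltnS leq_addr.
have h2 : (refine_c n j)%:R <= (80 + C2%:R) * v ^+ E.
  apply: le_trans (_ : (80 + C2%:R) * v ^+ e2.+1 <= _); last first.
    by apply: ler_wpM2l; [rewrite addr_ge0 ?ler0n|apply: vE; rewrite /E ltnS leq_addl].
  have hd : (down_c n)%:R <= C2%:R * v ^+ e2.
    apply: (@le_trans _ _ (C2 * n.+1 ^ e2)%:R); first by rewrite ler_nat.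
    by rewrite natrM ler_wpM2l ?ler0n // natrX; exact: np.
  rewrite /refine_c natrD natrM natrD.
  exact: (refine_total (ler0n _ _) (le_trans jz zv) (ler0n _ _) (ler0n _ _) v1 hd).
have h3 : (500 * k.+1 * N.+1)%:R <=
    1000 * (ln 2)^-1 * (k%:R * ln (aspect_ratio S)) + 8000 * v ^+ E.
  have k1 : 1 <= k%:R :> R by rewrite ler1n.
  rewrite natrM natrM -[k.+1%:R]natr1 -[N.+1%:R]natr1.
  exact: (coarse_total k1 (ler0n _ _) NL kE).
rewrite natrD (natrD _ _ (refine_c n j)) (natrD _ 100).
exact: (cost_total vE1 L0 (ler0n _ _) (ler0n _ _) q0 h1 h2 h3).
Qed.
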